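(* Define the spectral projection $\bar F_{k,h}:V_h\to{\rm span}\{\bar u_{1,h},\dots,\bar u_{k,h}\}$ by $$a_h(\bar F_{k,h}w_h,\bar u_{i,h})=a_h(w_h,\bar u_{i,h}),\quad i=1,\dots,k,\ \text{for } w_h\in V_h.$$ Then the exact eigenfunctions $u_1,\dots,u_k$ satisfy $$\left\|Q_hu_i-\bar F_{k,h}Q_hu_i\right\|_{a,h}\le2\|Q_hu_i-\mathcal P_hu_i\|_{a,h}+\frac{\sqrt{\bar\mu_{k+1,h}}}{\delta_{k,i,h}}\left\|Q_hu_i-\mathcal P_hu_i\right\|_{b,h},\quad 1\le i\le k,$$ where $$\delta_{k,i,h}=\min_{k<j\le N_h}\left|\frac1{\bar\lambda_{j,h}}-\frac1{\lambda_i}\right|.$$ Furthermore, these $k$ exact eigenfunctions satisfy $$\left\|Q_hu_i-\bar F_{k,h}Q_hu_i\right\|_{b,h}\le\left(2+\frac{\bar\mu_{k+1,h}}{\delta_{k,i,h}}\right)\left\|Q_hu_i-\mathcal P_hu_i\right\|_{b,h},\quad 1\le i\le k.$$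
   Context: Setting. $\Omega\subset\mathbb R^d$ ($d=2,3$) is a convex bounded polygonal or polyhedral domain, $A\in[L^\infty(\Omega)]^{d\times d}$ is a symmetric matrix-valued function with suitable regularity, satisfying $c\,\xi^T\xi\le\xi^TA(x)\xi\le C\,\xi^T\xi$ for all $\xi\in\mathbb R^d$, $x\in\Omega$, with positive constants $c,C$. $V=H_0^1(\Omega)$, $a(u,v)=(A\nabla u,\nabla v)$, $b(u,v)=(u,v)$. The exact eigenpairs $(\lambda,u)\in\mathbb R\times V$ satisfy $a(u,u)=1$ and $a(u,v)=\lambda b(u,v)$ for all $v\in V$; the eigenvalues are $0<\lambda_1\le\lambda_2\le\cdots$, with eigenfunctions $u_j$ such that $a(u_i,u_j)=\delta_{ij}$ (Kronecker delta). Weak Galerkin (WG) space. $\mathcal T_h$ is a shape-regular, quasi-uniform mesh of $\Omega$ by triangles/tetrahedra with edges/faces $\mathcal E_h$ and mesh size $h$. Fix an integer $r\ge0$ and $s\in\{r,r+1\}$. $V_h$ is the space of $v=\{v_0,v_b\}$ with $v_0|_K\in\mathcal P_r(K)$ for each $K\in\mathcal T_h$, $v_b|_e\in\mathcal P_s(e)$ for each $e\in\mathcal E_h$, and $v_b|_e=0$ for $e\subset\partial\Omega$, where $\mathcal P_m$ denotes polynomials of degree at most $m$; no continuity between $v_0$ and $v_b$ is required. Set $G_r(K)=[\mathcal P_r(K)]^d+\widehat{\mathcal P}_r(K)\mathbf x$ if $s=r$ (Raviart-Thomas), with $\widehat{\mathcal P}_r(K)$ the homogeneous polynomials of degree $r$,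 and $G_r(K)=[\mathcal P_{r+1}(K)]^d$ if $s=r+1$ (Brezzi-Douglas-Marini). The discrete weak gradient $\nabla_wv$ of $v\in V_h$ is defined on each $K$ by $\nabla_wv|_K\in G_r(K)$ and $(\nabla_wv,\mathbf q)_K=-(v_0,\nabla\cdot\mathbf q)_K+\langle v_b,\mathbf q\cdot\mathbf n\rangle_{\partial K}$ for all $\mathbf q\in G_r(K)$, $\mathbf n$ being the unit outward normal. Put $a_h(u,v)=\sum_K(A\nabla_wu,\nabla_wv)_K$, $b_h(u,v)=\sum_K(u_0,v_0)_K$, $\|v\|_{a,h}=\sqrt{a_h(v,v)}$, $\|v\|_{b,h}=\sqrt{b_h(v,v)}$; for $u\in V$ and $v\in V_h$, $b_h(u,v)=\sum_K(u,v_0)_K$. Operators. $Q_hv=\{Q_0v,Q_bv\}\in V_h$ for $v\in V$, where $Q_0$ is the elementwise $L^2$ projection onto $\mathcal P_r(K)$ and $Q_b$ the $L^2$ projection onto $\mathcal P_s(e)$ on each edge/face. For an exact eigenpair $(\lambda,u)$, $\mathcal P_hu\in V_h$ is defined by $a_h(\mathcal P_hu,v_h)=\lambda b_h(u,v_h)$ for all $v_h\in V_h$. Discrete eigenvalue problem. Find $(\bar\lambda_h,\bar u_h)\in\mathbb R\times V_h$ with $a_h(\bar u_h,\bar u_h)=1$ and $a_h(\bar u_h,v_h)=\bar\lambda_hb_h(\bar u_h,v_h)$ for all $v_h\in V_h$. The eigenvalues are $0<\bar\lambda_{1,h}\le\cdots\le\bar\lambda_{N_h,h}$, where $N_h=\dim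 V_h$, with eigenfunctions $\bar u_{1,h},\dots,\bar u_{N_h,h}$ satisfying $a_h(\bar u_{i,h},\bar u_{j,h})=\delta_{ij}$. Set $\bar\mu_{j,h}=1/\bar\lambda_{j,h}$.
   Formalization: N_h is taken as the dimension of {v_0 : v in V_h}, the number of finite discrete eigenvalues, rather than dim V_h, since b_h vanishes on {0, v_b} and dim V_h a_h-orthonormal eigenfunctions with real eigenvalues cannot exist; k < N_h and δ_{k,i,h} > 0 are assumed. *)

(* Defs.v *)
From HB Require Import structures.
From mathcomp Require Import all_boot all_order all_algebra.
From mathcomp Require Import all_classical all_reals all_analysis.
Set Implicit Arguments. Unset Strict Implicit. Unset Printing Implicit Defensive.
Import Order.TTheory GRing.Theory Num.Theory.
Import numFieldNormedType.Exports.
Local Open Scope classical_set_scope.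
Local Open Scope ring_scope.

(* Borel sigma-algebra of R^n, generated by the coordinates. *)
Section borel_rV.
Context {R : realType} (n : nat).

Let coord (i : 'I_n) (x : 'rV[R]_n) : R := x 0 i.

Let rV_set0 : g_sigma_preimage coord set0.
Proof. exact: sigma_algebra0. Qed.

Let rV_setC A : g_sigma_preimage coord A -> g_sigma_preimage coord (~` A).
Proof. exact: sigma_algebraC. Qed.

Let rV_bigcup (F : _^nat) : (forall i, g_sigma_preimage coord (F i)) ->
  g_sigma_preimage coord (\bigcup_i (F i)).
Proof. exact: sigma_algebra_bigcup. Qed.

HB.instance Definition _ := @isMeasurable.Build
  (measure_tuple_display default_measure_display)
  'rV[R]_n (g_sigma_preimage coord) rV_set0 rV_setC rV_bigcup.
End borel_rV.


Lemma measurable_fun_rVP {R : realType} d (T : measurableType d) n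
    (f : T -> 'rV[R]_n) :
  measurable_fun [set: T] f <->
  forall i, measurable_fun [set: T] (fun t => f t 0 i : R).
Proof.
apply: (@iff_trans _ (g_sigma_preimage
    (fun i t => f t 0 i) `<=` measurable)).
  rewrite (g_sigma_preimage_comp (fun (i : 'I_n) (x : 'rV[R]_n) => x 0 i) f).
  split=> [mf A [/= C preC <-]|prefS].
    exact: mf.
  by move=> _ A mA; apply: prefS; exists A.
split=> [fS i|mf].
- move=> _ A mA.
  apply: fS; apply: sub_sigma_algebra.
  case: n i => [[] []//|n i] in f *.
  rewrite -bigcup_mkord_ord.
  exists i; first exact: ltn_ord.
  by exists A => //; rewrite inord_val.
- apply: smallest_sub; first exact: sigma_algebra_measurable.
  case: n => [|n] in f mf *; first by rewrite big_ord0.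
  rewrite -bigcup_mkord_ord; apply: bigcup_sub => i Ii.
  by move=> A [B mB <-]; exact: mf.
Qed.

Lemma measurable_coord {R : realType} n (i : 'I_n) :
  measurable_fun [set: 'rV[R]_n] (fun x => x 0 i : R).
Proof. by move: i; apply/(measurable_fun_rVP id); exact: measurable_id. Qed.

(* Lebesgue measure on R^n, as the n-fold product of the one-dimensional one. *)
Section lebesgue_rV.
Context {R : realType}.

Definition cons_rV n (p : R * 'rV[R]_n) : 'rV[R]_n.+1 :=
  row_mx (p.1)%:M p.2 : 'rV_(1 + n).

Fixpoint leb n : set 'rV[R]_n -> \bar R :=
  match n with
  | 0%N => \d_(0 : 'rV[R]_0)
  | n.+1 => pushforward ((@lebesgue_measure R) \x @leb n)%E (@cons_rV n)
  end.

Let uncons_rV n (x : 'rV[R]_n.+1) : R * 'rV[R]_n :=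
  (x 0 0, rsubmx (x : 'rV_(1 + n))).

Let uncons_rVK n : cancel (@uncons_rV n) (@cons_rV n).
Proof.
move=> x; apply/rowP => i; rewrite /cons_rV /=.
case: (@split_ordP 1 n i) => j ->.
  apply: (etrans (row_mxEl _ _ _ _)).
  by rewrite ord1 mxE mulr1n; congr (x _ _); exact: val_inj.
by apply: (etrans (row_mxEr _ _ _ _)); rewrite mxE.
Qed.

Let cons_rVK n : cancel (@cons_rV n) (@uncons_rV n).
Proof.
move=> [a v]; rewrite /uncons_rV /cons_rV row_mxKr; congr pair => //=.
rewrite (_ : 0 = lshift n (0 : 'I_1)); last exact: val_inj.
apply: (etrans (row_mxEl _ _ _ _)).
by rewrite mxE mulr1n.
Qed.

Lemma measurable_cons_rV n : measurable_fun setT (@cons_rV n).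
Proof.
apply/measurable_fun_rVP => i.
rewrite /cons_rV; case: (@split_ordP 1 n i) => j ->.
- rewrite (_ : (fun _ => _) = fst); first exact: measurable_fst.
  apply/funext => p; apply: (etrans (row_mxEl _ _ _ _)).
  by rewrite ord1 mxE mulr1n.
- rewrite (_ : (fun _ => _) = (fun x : 'rV[R]_n => x 0 j) \o snd).
    exact: measurableT_comp (measurable_coord j) measurable_snd.
  by apply/funext => p; apply: (etrans (row_mxEr _ _ _ _)).
Qed.

Let measurable_uncons_rV n : measurable_fun setT (@uncons_rV n).
Proof.
apply/measurable_fun_pairP; split; first exact: measurable_coord.
apply/measurable_fun_rVP => i.
rewrite (_ : (fun _ => _) = (fun x : 'rV[R]_n.+1 => x 0 (rshift 1 i))).
  exact: measurable_coord.
by apply/funext => x; rewrite /= mxE.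
Qed.

Let prod_sf d1 d2 (T1 : measurableType d1) (T2 : measurableType d2)
  (m1 : {sigma_finite_measure set T1 -> \bar R})
  (m2 : {sigma_finite_measure set T2 -> \bar R}) :
  sigma_finite setT (m1 \x m2)%E.
Proof.
have /sigma_finiteP[F [TF ndF Foo]] := sigma_finiteT m1.
have /sigma_finiteP[G [TG ndG Goo]] := sigma_finiteT m2.
exists (fun n => F n `*` G n).
  rewrite -setXTT TF TG predeqE => -[x y]; split.
    move=> [/= [n _ Fnx] [k _ Gky]]; exists (maxn n k) => //; split.
    - by move: x Fnx; exact/subsetPset/ndF/leq_maxl.
    - by move: y Gky; exact/subsetPset/ndG/leq_maxr.
  by move=> [n _ []/= ? ?]; split; exists n.
move=> k; have [? ?] := Foo k; have [? ?] := Goo k.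
split; first exact: measurableX.
by rewrite product_measure1E// lte_mul_pinfty// ge0_fin_numE.
Qed.

Let pack_sf d (T : measurableType d) (mu : set T -> \bar R) :
  mu set0 = 0%E -> (forall A, (0 <= mu A)%E) -> semi_sigma_additive mu ->
  sigma_finite setT mu ->
  exists m : {sigma_finite_measure set T -> \bar R}, mu = m.
Proof.
move=> m0 mge0 msa msf.
pose M1 := isMeasure.Build _ _ _ mu m0 mge0 msa.
pose mm : {measure set T -> \bar R} := HB.pack mu M1.
pose M2 := Measure_isSigmaFinite.Build _ _ _ mm msf.
pose mm' : {sigma_finite_measure set T -> \bar R} := HB.pack mu M1 M2.
by exists mm'.
Qed.

Let leb_measure n : exists m : {sigma_finite_measure set 'rV[R]_n -> \bar R},
  leb (n := n) = m.
Proof.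
elim: n => [|n [m /= em]]; first by exists \d_(0 : 'rV[R]_0).
rewrite em.
pose mu := pushforward ((@lebesgue_measure R) \x m)%E (@cons_rV n).
have m0 : mu set0 = 0%E by rewrite /mu /pushforward preimage_set0 measure0.
have mge0 A : (0 <= mu A)%E by rewrite /mu /pushforward measure_ge0.
have msa : semi_sigma_additive mu.
  move=> F mF tF mUF; rewrite /mu /pushforward preimage_bigcup.
  have mp A : measurable A -> measurable (@cons_rV n @^-1` A).
    by move=> mA; rewrite -[X in measurable X]setTI; exact: measurable_cons_rV.
  apply: measure_semi_sigma_additive.
  - by move=> k; exact: mp.
  - apply/trivIsetP => /= i j _ _ ij; rewrite -preimage_setI.
    by move/trivIsetP : tF => /(_ _ _ _ _ ij) ->//; rewrite preimage_set0.
  - by rewrite -preimage_bigcup; exact: mp.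
have msf : sigma_finite setT mu.
  have [F [FT mF]] := prod_sf (@lebesgue_measure R) m.
  exists (fun k => @uncons_rV n @^-1` F k).
    by rewrite -preimage_bigcup -FT preimage_setT.
  move=> k; split.
    rewrite -[X in measurable X]setTI; apply: measurable_uncons_rV => //.
    by have [] := mF k.
  rewrite /mu /pushforward -comp_preimage.
  rewrite (_ : _ \o _ = id); last by apply/funext => p /=; rewrite cons_rVK.
  by rewrite preimage_id; have [] := mF k.
exact: pack_sf m0 mge0 msa msf.
Qed.

Let leb0 n : leb (set0 : set 'rV[R]_n) = 0%E.
Proof. by have [m ->] := leb_measure n; exact: measure0. Qed.

Let leb_ge0 n (A : set 'rV[R]_n) : (0 <= leb A)%E.
Proof. by have [m ->] := leb_measure n; exact: measure_ge0. Qed.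

Let leb_sigma_additive n : semi_sigma_additive (@leb n).
Proof. by have [m ->] := leb_measure n; exact: measure_semi_sigma_additive. Qed.

HB.instance Definition _ n := isMeasure.Build _ _ _ (@leb n)
  (@leb0 n) (@leb_ge0 n) (@leb_sigma_additive n).

Let leb_sigma_finite n : sigma_finite setT (@leb n).
Proof. by have [m ->] := leb_measure n; exact: sigma_finiteT. Qed.

HB.instance Definition _ n := Measure_isSigmaFinite.Build _ _ _ (@leb n)
  (@leb_sigma_finite n).

End lebesgue_rV.

Section euclidean.
Context {R : realType} {d : nat}.
Implicit Types (u v x : 'rV[R]_d) (S : set 'rV[R]_d).

Definition dot u v : R := (u *m v^T) 0 0.

(* The library's norm on 'rV_d is the maximum norm, hence this one. *)
Definition enorm u : R := Num.sqrt (dot u u).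

Definition diameter S : R :=
  sup [set rho | exists x y, [/\ S x, S y & rho = enorm (x - y)]].

Definition inscribed_diameter S : R :=
  sup [set rho | exists x, [set y | enorm (y - x) < rho / 2] `<=` S].

(* Nonempty bounded intersections of finitely many open half-spaces. *)
Definition convex_polytopal_domain (Omega : set 'rV[R]_d) : Prop :=
  [/\ Omega !=set0,
      exists B : R, forall x, Omega x -> enorm x <= B &
      exists (m : nat) (nu : 'I_m -> 'rV[R]_d) (c : 'I_m -> R),
        Omega = [set x | forall i, dot (nu i) x < c i]].

Definition frontier S : set 'rV[R]_d := closure S `\` S^°.

End euclidean.

Section sobolev_spaces.
Context {R : realType} {d : nat}.
Implicit Types (f g : 'rV[R]_d -> R) (Omega : set 'rV[R]_d).

Definition partial (i : 'I_d) f : 'rV[R]_d -> R :=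
  fun x => derive1 (fun t : R => f (x + t *: delta_mx 0 i)) 0.

Definition smooth f : Prop := forall s : seq 'I_d,
  continuous (foldr partial f s) /\
  forall i x, derivable
    (fun t : R => foldr partial f s (x + t *: delta_mx 0 i)) 0 1.

Definition test_function Omega f : Prop := smooth f /\
  exists C, [/\ compact C, C `<=` Omega & forall x, ~ C x -> f x = 0].

Definition L2 Omega f : Prop := measurable_fun Omega f /\
  (@leb R d).-integrable Omega (fun x => (f x ^+ 2)%:E).

Definition L2_cvg Omega (f_ : nat -> 'rV[R]_d -> R) f : Prop :=
  (fun n => \int[@leb R d]_(x in Omega) (f_ n x - f x) ^+ 2) @ \oo --> (0 : R).

(* A Sobolev function together with a representative of its weak gradient. *)
Record sobolev := Sobolev {
  sfun : 'rV[R]_d -> R;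
  sgrad : 'rV[R]_d -> 'rV[R]_d }.

Definition is_weak_gradient Omega (u : sobolev) : Prop :=
  forall i phi, test_function Omega phi ->
    \int[@leb R d]_(x in Omega) (sfun u x * partial i phi x) =
    - \int[@leb R d]_(x in Omega) (sgrad u x 0 i * phi x).

Definition H1 Omega (u : sobolev) : Prop :=
  [/\ L2 Omega (sfun u), forall i, L2 Omega (fun x => sgrad u x 0 i) &
      is_weak_gradient Omega u].

Definition H1_cvg Omega (phi : nat -> 'rV[R]_d -> R) (u : sobolev) : Prop :=
  L2_cvg Omega phi (sfun u) /\
  forall i, L2_cvg Omega (fun n => partial i (phi n)) (fun x => sgrad u x 0 i).

Definition H10 Omega (u : sobolev) : Prop := H1 Omega u /\
  exists phi, (forall n, test_function Omega (phi n)) /\ H1_cvg Omega phi u.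

End sobolev_spaces.
Arguments sobolev : clear implicits.

Section exact_problem.
Context {R : realType} {d : nat} (Omega : set 'rV[R]_d).
Context (A : 'rV[R]_d -> 'M[R]_d).
Implicit Types u v : sobolev R d.

Definition coefficient (c C : R) : Prop :=
  [/\ forall i j, measurable_fun Omega (fun x => A x i j),
      forall i j, exists B : R, {ae @leb R d, forall x, Omega x -> `|A x i j| <= B},
      forall x, Omega x -> (A x)^T = A x &
      forall x (xi : 'cV[R]_d), Omega x ->
        c * (xi^T *m xi) 0 0 <= (xi^T *m A x *m xi) 0 0 <= C * (xi^T *m xi) 0 0].

Definition a_form u v : R := \int[@leb R d]_(x in Omega)
  dot (sgrad u x *m (A x)^T) (sgrad v x).

Definition b_form u v : R := \int[@leb R d]_(x in Omega) (sfun u x * sfun v x).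

Definition exact_eigenpair (lam : R) u : Prop :=
  [/\ H10 Omega u, a_form u u = 1 &
      forall v, H10 Omega v -> a_form u v = lam * b_form u v].

(* All the eigenvalues, repeated according to multiplicity, numbered from 1
   (the values at 0 are irrelevant). *)
Definition exact_eigensystem (lam : nat -> R) (u : nat -> sobolev R d) : Prop :=
  [/\ forall j, (0 < j)%N -> 0 < lam j /\ exact_eigenpair (lam j) (u j),
      forall i j, (0 < i <= j)%N -> lam i <= lam j,
      forall i j, (0 < i)%N -> (0 < j)%N -> a_form (u i) (u j) = (i == j)%:R &
      forall mu w, exact_eigenpair mu w -> exists (n : nat) (c : nat -> R),
        {ae @leb R d, forall x, Omega x ->
          sfun w x = \sum_(1 <= j < n.+1 | lam j == mu) c j * sfun (u j) x}].

End exact_problem.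

Section polynomials.
Context {R : realType} {d : nat}.

(* Linear combinations of the monomials x^a whose degree satisfies D; a bound m
   on the exponents makes the multi-indices a finite type. *)
Definition poly_fun (m : nat) (D : pred nat)
    (c : {ffun 'I_d -> 'I_m.+1} -> R) : 'rV[R]_d -> R :=
  fun x => \sum_(a : {ffun 'I_d -> 'I_m.+1} | D (\sum_i a i)%N)
    c a * \prod_i x 0 i ^+ a i.

(* Polynomial functions of degree at most m, resp. homogeneous of degree m. *)
Definition Pol (m : nat) : set ('rV[R]_d -> R) :=
  range (poly_fun (m := m) (fun e => (e <= m)%N)).

Definition hPol (m : nat) : set ('rV[R]_d -> R) :=
  range (poly_fun (m := m) (fun e => e == m)).

(* Raviart-Thomas space if s = r, Brezzi-Douglas-Marini space otherwise. *)
Definition Gr (r s : nat) : set ('rV[R]_d -> 'rV[R]_d) :=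
  if s == r then
    [set q | exists p m, [/\ forall i, Pol r (fun x => p x 0 i), hPol r m &
                          forall x, q x = p x + m x *: x]]
  else [set q | forall i, Pol r.+1 (fun x => q x 0 i)].

Definition divergence (q : 'rV[R]_d -> 'rV[R]_d) : 'rV[R]_d -> R :=
  fun x => \sum_i partial i (fun y => q y 0 i) x.

End polynomials.

(* A simplex is the set of its vertices. *)
Record mesh (R : realType) (d : nat) := Mesh {
  node : finType;
  pos : node -> 'rV[R]_d;
  cells : {set {set node}} }.

Section mesh_theory.
Context {R : realType} {d : nat} (M : mesh R d).
Implicit Types (S K F : {set node M}).

Definition simplex S : set 'rV[R]_d :=
  [set x | exists t : node M -> R, [/\ forall p, p \in S -> 0 <= t p,
     \sum_(p in S) t p = 1 & x = \sum_(p in S) t p *: pos p]].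

Definition open_simplex S : set 'rV[R]_d :=
  [set x | exists t : node M -> R, [/\ forall p, p \in S -> 0 < t p,
     \sum_(p in S) t p = 1 & x = \sum_(p in S) t p *: pos p]].

Definition affinely_independent S : Prop := forall t : node M -> R,
  \sum_(p in S) t p = 0 -> \sum_(p in S) t p *: pos p = 0 ->
  forall p, p \in S -> t p = 0.

Definition is_mesh (Omega : set 'rV[R]_d) : Prop :=
  [/\ forall K, K \in cells M -> [/\ #|K| = d.+1, affinely_independent K &
                                 open_simplex K `<=` Omega],
      closure Omega = \bigcup_(K in [set K | K \in cells M]) simplex K &
      forall K K', K \in cells M -> K' \in cells M ->
        simplex K `&` simplex K' = simplex (K :&: K')].

Definition mesh_size : R :=
  \big[Num.max/0]_(K in cells M) diameter (simplex K).

Definition shape_regular (sigma : R) : Prop := forall K, K \in cells M ->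
  diameter (simplex K) <= sigma * inscribed_diameter (simplex K).

Definition quasi_uniform (tau : R) : Prop := forall K, K \in cells M ->
  mesh_size <= tau * diameter (simplex K).

Definition faces_of K : {set {set node M}} :=
  [set F : {set node M} | (F \subset K) && (#|F| == d)].

Definition faces : {set {set node M}} :=
  \bigcup_(K in cells M) faces_of K.

Definition cell_int K (f : 'rV[R]_d -> R) : R :=
  \int[@leb R d]_(x in open_simplex K) f x.

(* Surface integral over a face, by the affine parametrisation
   x = v_0 + sum_i t_i (v_(i+1) - v_0) of its simplex by the reference
   (d-1)-simplex; the area element is the square root of the Gram determinant. *)
Definition face_vertex F (j : nat) : 'rV[R]_d :=
  nth 0 [seq pos p | p <- enum F] j.

Definition face_edge F (i : nat) : 'rV[R]_d :=
  face_vertex F i.+1 - face_vertex F 0.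

Definition face_param F (t : 'rV[R]_d.-1) : 'rV[R]_d :=
  face_vertex F 0 + \sum_(i < d.-1) t 0 i *: face_edge F i.

Definition ref_simplex : set 'rV[R]_d.-1 :=
  [set t | (forall i, 0 <= t 0 i) /\ \sum_i t 0 i <= 1].

Definition face_jacobian F : R := Num.sqrt
  (\det (\matrix_(i < d.-1, j < d.-1) dot (face_edge F i) (face_edge F j))).

Definition face_int F (f : 'rV[R]_d -> R) : R :=
  face_jacobian F * \int[@leb R d.-1]_(t in ref_simplex) f (face_param F t).

Definition face_L2 F (f : 'rV[R]_d -> R) : Prop :=
  measurable_fun ref_simplex (f \o face_param F) /\
  (@leb R d.-1).-integrable ref_simplex (fun t => (f (face_param F t) ^+ 2)%:E).

Definition outward_normal K F : 'rV[R]_d := xget 0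
  [set n | [/\ dot n n = 1,
     forall p q, p \in F -> q \in F -> dot n (pos p - pos q) = 0 &
     forall p q, p \in F -> q \in K :\: F -> dot n (pos q - pos p) < 0]].

(* Trace on F of an element of the H^1-closure of the test functions. *)
Definition is_trace Omega (v : sobolev R d) F (g : 'rV[R]_d -> R) : Prop :=
  face_L2 F g /\
  exists phi, [/\ forall n, test_function Omega (phi n), H1_cvg Omega phi v &
    (fun n => face_int F (fun x => (phi n x - g x) ^+ 2)) @ \oo --> (0 : R)].

End mesh_theory.

(* The dimension of a space of functions is n. *)
Definition has_dim (R : realType) (E : lmodType R) (W : set E) (n : nat) : Prop :=
  exists e : 'I_n -> E,
    W = [set \sum_i c i *: e i | c in [set: 'I_n -> R]] /\
    forall c : 'I_n -> R, \sum_i c i *: e i = 0 -> forall i, c i = 0.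

Section weak_galerkin.
Context {R : realType} {d : nat} (Omega : set 'rV[R]_d) (M : mesh R d).
Context (r s : nat) (A : 'rV[R]_d -> 'M[R]_d).

(* v = {v_0, v_b}: v.1 K is v_0 on the cell K and v.2 F is v_b on the face F,
   both represented by polynomial functions on the whole of R^d. *)
Definition wg : Type :=
  (({set node M} -> 'rV[R]_d -> R) * ({set node M} -> 'rV[R]_d -> R))%type.
HB.instance Definition _ := GRing.Lmodule.on wg.
Implicit Types (u v w : wg) (K F : {set node M}).

Definition Vh : set wg := [set v |
  [/\ forall K, K \in cells M -> Pol r (v.1 K),
      forall F, F \in faces M -> Pol s (v.2 F) &
      forall F, F \in faces M -> simplex F `<=` frontier Omega ->
        forall x, simplex F x -> v.2 F x = 0]].

Definition weak_grad v K : 'rV[R]_d -> 'rV[R]_d := xget (fun=> 0)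
  [set g | Gr r s g /\ forall q, Gr r s q ->
    cell_int K (fun x => dot (g x) (q x)) =
      - cell_int K (fun x => v.1 K x * divergence q x) +
      \sum_(F in faces_of K)
        face_int F (fun x => v.2 F x * dot (q x) (outward_normal K F))].

Definition ah u v : R := \sum_(K in cells M)
  cell_int K (fun x => dot (weak_grad u K x *m (A x)^T) (weak_grad v K x)).

Definition bh u v : R := \sum_(K in cells M)
  cell_int K (fun x => u.1 K x * v.1 K x).

(* b_h(u, v) for u in H^1_0 and v in V_h *)
Definition bh_mixed (u : sobolev R d) v : R := \sum_(K in cells M)
  cell_int K (fun x => sfun u x * v.1 K x).

Definition norm_ah v : R := Num.sqrt (ah v v).

Definition norm_bh v : R := Num.sqrt (bh v v).

Definition is_Qh (v : sobolev R d) (q : wg) : Prop :=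
  [/\ Vh q,
      forall K, K \in cells M -> forall p, Pol r p ->
        cell_int K (fun x => q.1 K x * p x) = cell_int K (fun x => sfun v x * p x) &
      forall F, F \in faces M -> exists2 g, is_trace Omega v F g &
        forall p, Pol s p ->
          face_int F (fun x => q.2 F x * p x) = face_int F (fun x => g x * p x)].

Definition is_Ph (lam : R) (u : sobolev R d) (p : wg) : Prop :=
  Vh p /\ forall v, Vh v -> ah p v = lam * bh_mixed u v.

(* The space {v_0 : v in V_h} of piecewise polynomials. *)
Definition interior_space : set ({set node M} -> 'rV[R]_d -> R) :=
  [set (fun K => if K \in cells M then v.1 K \_ (open_simplex K) else 0) | v in Vh].

(* The form b_h vanishes on all {0, v_b}, so that the number N of (finite)
   discrete eigenvalues, counted with multiplicity, is the dimension of
   {v_0 : v in V_h}; it is smaller than dim V_h as soon as there are interior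
   faces. Numbering starts at 1. *)
Definition discrete_eigensystem (N : nat) (lamh : nat -> R) (uh : nat -> wg) : Prop :=
  [/\ has_dim interior_space N,
      forall j, (0 < j <= N)%N -> [/\ Vh (uh j), 0 < lamh j &
        forall v, Vh v -> ah (uh j) v = lamh j * bh (uh j) v],
      forall i j, (0 < i)%N -> (i <= j <= N)%N -> lamh i <= lamh j &
      forall i j, (0 < i <= N)%N -> (0 < j <= N)%N ->
        ah (uh i) (uh j) = (i == j)%:R].

Definition is_spectral_projection (uh : nat -> wg) (k : nat) (Fk : wg -> wg) : Prop :=
  forall w, Vh w ->
    (exists c : nat -> R, Fk w = \sum_(1 <= i < k.+1) c i *: uh i) /\
    forall i, (1 <= i <= k)%N -> ah (Fk w) (uh i) = ah w (uh i).

End weak_galerkin.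

(* min over k < j <= N; the initial value is the term j = k + 1, which is in
   the range when k < N. *)
Definition spectral_gap (R : realType) (N : nat) (lamh : nat -> R) (k : nat)
    (lam : R) : R :=
  \big[Num.min/ `|(lamh k.+1)^-1 - lam^-1| ]_(k.+1 <= j < N.+1)
    `|(lamh j)^-1 - lam^-1|.

(* Main.v *)
Require Import Defs.
From HB Require Import structures.
From mathcomp Require Import all_boot all_order all_algebra.
From mathcomp Require Import all_classical all_reals all_analysis.
From mathcomp Require Import measurable_realfun ring lra.
Set Implicit Arguments. Unset Strict Implicit. Unset Printing Implicit Defensive.
Import Order.TTheory GRing.Theory Num.Theory.
Import numFieldNormedType.Exports.
Local Open Scope classical_set_scope.
Local Open Scope ring_scope.

(* Each discrete eigenvector is an eigenvector of both forms, so for the Galerkin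
   approximation p of the i-th exact eigenfunction and g = q - p,
     (1/lam_i - 1/lamh_j) a_h(p, uh_j) = b_h(g, uh_j)   for every j.
   Hence the component of p along uh_j is at most |b_h(g, uh_j)| / delta for
   j > k, and Bessel's inequality in b_h bounds p - F p in both norms.  As F is
   an orthogonal projection for a_h and for b_h, q - F q = (g - F g) + (p - F p)
   gives the two estimates.

   The part of p outside the span of the uh_j has b_h-norm zero, since the
   interior components of the uh_j span those of V_h, and the equation for p
   then makes its a_h-norm vanish too.

   That a_h is bilinear amounts to the well-posedness of the discrete weak
   gradient: on a cell, the L^2 form on G_r(K) is definite because a cell has
   nonempty interior, so the defining system is uniquely solvable. *)

(** * Linearity of the integral on bounded measurable functions *)

Section bounded_measurable.
Context d (T : measurableType d) (R : realType).
Variable mu : {measure set T -> \bar R}.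
Variable D : set T.
Implicit Types f g : T -> R.

(** Linearity of [Rintegral] requires integrability. On a set of finite measure this class is
    contained in the integrable functions, and unlike them it is stable under products. *)
Definition bounded_measurable f : Prop :=
  measurable_fun D f /\ exists B : R, forall x, D x -> `|f x| <= B.

Lemma bounded_measurable_cst (c : R) : bounded_measurable (fun=> c).
Proof. by split; [exact: measurable_cst | exists `|c|]. Qed.

Lemma bounded_measurableD f g : bounded_measurable f -> bounded_measurable g ->
  bounded_measurable (fun x => f x + g x).
Proof.
move=> [mf [B fB]] [mg [B' gB]]; split; first exact: measurable_funD.
exists (B + B') => x Dx; apply: (le_trans (ler_normD _ _)).
by apply: lerD; [exact: fB | exact: gB].
Qed.

Lemma bounded_measurableM f g : bounded_measurable f -> bounded_measurable g ->
  bounded_measurable (fun x => f x * g x).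
Proof.
move=> [mf [B fB]] [mg [B' gB]]; split; first exact: measurable_funM.
exists (B * B') => x Dx; rewrite normrM.
by apply: ler_pM => //; [exact: fB | exact: gB].
Qed.

Lemma bounded_measurable_sum (I : Type) (s : seq I) (P : pred I)
    (F : I -> T -> R) : (forall i, P i -> bounded_measurable (F i)) ->
  bounded_measurable (fun x => \sum_(i <- s | P i) F i x).
Proof.
move=> bF; elim: s => [|i s IH].
  by under eq_fun do rewrite big_nil; exact: bounded_measurable_cst.
under eq_fun do rewrite big_cons.
by case: (boolP (P i)) => // Pi; apply: bounded_measurableD => //; exact: bF.
Qed.

Hypotheses (mD : measurable D) (muD : (mu D < +oo)%E).

Lemma bounded_measurable_integrable f : bounded_measurable f ->
  mu.-integrable D (EFin \o f).
Proof.
move=> [mf [B fB]]; apply: measurable_bounded_integrable => //.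
by exists B; split; [exact: num_real | move=> x Bx y Dy; exact: le_trans (fB _ Dy) (ltW Bx)].
Qed.

Lemma RintegralD_bounded f g : bounded_measurable f -> bounded_measurable g ->
  \int[mu]_(x in D) (f x + g x) = \int[mu]_(x in D) f x + \int[mu]_(x in D) g x.
Proof. by move=> bf bg; apply: RintegralD => //; exact: bounded_measurable_integrable. Qed.

Lemma RintegralZl_bounded (c : R) f : bounded_measurable f ->
  \int[mu]_(x in D) (c * f x) = c * \int[mu]_(x in D) f x.
Proof. by move=> bf; apply: RintegralZl => //; exact: bounded_measurable_integrable. Qed.

Lemma Rintegral_sum_bounded (I : Type) (s : seq I) (c : I -> R) (F : I -> T -> R) :
  (forall i, bounded_measurable (F i)) ->
  \int[mu]_(x in D) (\sum_(i <- s) c i * F i x) =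
  \sum_(i <- s) c i * \int[mu]_(x in D) F i x.
Proof.
move=> bF.
have bcF i : bounded_measurable (fun x => c i * F i x).
  by apply: bounded_measurableM => //; exact: bounded_measurable_cst.
elim: s => [|i s IH].
  rewrite (_ : (fun x => _) = fun=> 0); last by apply/funext => x; rewrite big_nil.
  rewrite big_nil.
  by rewrite Rintegral_cst// mul0r.
rewrite big_cons -IH -RintegralZl_bounded// -RintegralD_bounded//.
  by congr (Rintegral _ _ _); apply/funext => x; rewrite big_cons.
exact: bounded_measurable_sum.
Qed.

End bounded_measurable.

(** * Lebesgue measure of boxes and of bounded sets *)

Section lebesgue_box.
Context {R : realType}.

(** The open max-norm ball, written coordinate by coordinate: the sigma-algebra is generated by the
    coordinates, and the measure is an iterated product. *)
Definition box n (c : 'rV[R]_n) (e : R) : set 'rV[R]_n :=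
  [set x | forall i, ball (c 0 i) e (x 0 i)].

Lemma box_bigcap n (c : 'rV[R]_n) e :
  box c e = \bigcap_i ((fun x : 'rV[R]_n => x 0 i) @^-1` ball (c 0 i) e).
Proof. by apply/seteqP; split => x /= xb i => [_|]; [exact: xb | exact: (xb i)]. Qed.

Lemma measurable_box n (c : 'rV[R]_n) e : measurable (box c e).
Proof.
rewrite box_bigcap; apply: fin_bigcap_measurable => // i _.
rewrite -[X in measurable X]setTI; apply: measurable_coord => //.
exact: measurable_ball.
Qed.

(** Induction on the dimension: pulled back by [cons_rV], a box is the product of an interval and a
    box of one dimension less. In dimension 0 the Dirac mass gives 1. *)
Lemma leb_box n (c : 'rV[R]_n) e : 0 <= e -> @leb R n (box c e) = ((e *+ 2) ^+ n)%:E.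
Proof.
move=> e0; elim: n c => [|n IH] c /=.
  by rewrite diracE mem_set//= => -[].
rewrite /pushforward.
pose c' : 'rV[R]_n := \row_j c 0 (rshift 1 j).
have -> : (@cons_rV R n) @^-1` box c e = ball (c 0 0) e `*` box c' e.
  have h0 : (0 : 'I_n.+1) = lshift n (0 : 'I_1) by exact: val_inj.
  apply/seteqP; split => -[a v] /=.
    move=> H; split => /= [|i].
      have := H 0; rewrite /cons_rV {2}h0.
      by rewrite (row_mxEl (a%:M : 'rV[R]_1) v) mxE mulr1n.
    have := H (rshift 1 i); rewrite /cons_rV (row_mxEr (a%:M : 'rV[R]_1) v) /c'.
    by rewrite mxE.
  move=> [/= Ha Hv] i; rewrite /cons_rV; case: (@split_ordP 1 n i) => j ->.
    rewrite (row_mxEl (a%:M : 'rV[R]_1) v) ord1 mxE mulr1n -h0; exact: Ha.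
  by rewrite (row_mxEr (a%:M : 'rV[R]_1) v); have := Hv j; rewrite mxE.
rewrite product_measure1E; [|exact: measurable_ball|exact: measurable_box].
rewrite exprS EFinM; congr (_ * _)%E; last exact: IH.
exact: lebesgue_measure_ball.
Qed.

Lemma leb_bounded_lty n (D : set 'rV[R]_n) (B : R) : measurable D ->
  (forall x, D x -> forall i, `|x 0 i| <= B) -> (@leb R n D < +oo)%E.
Proof.
(* The radius [|B| + 1] is positive whatever the sign of [B], and the extra 1 lets the open box
   contain points where the bound [B] is attained. *)
move=> mD DB; apply: (@le_lt_trans _ _ (@leb R n (box 0 (`|B| + 1)))).
  apply: le_measure; rewrite ?inE//; first exact: measurable_box.
  move=> x Dx i; rewrite mxE /ball/= sub0r normrN.
  by apply: (le_lt_trans (DB x Dx i)); rewrite (le_lt_trans (ler_norm _))// ltrDl.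
by rewrite leb_box ?ltry// addr_ge0.
Qed.

End lebesgue_box.

(** * Polynomial functions: calculus, measurability and vanishing *)

Section polynomial_functions.
Context {R : realType}.

(** An inductive closure without degrees, so that continuity, measurability, boundedness and
    differentiation are proved by structural induction. It covers [Pol], the components of [Gr] and
    their pullbacks to the reference simplex. *)
Inductive polynomial_function n : ('rV[R]_n -> R) -> Prop :=
| polynomial_cst c : polynomial_function (fun=> c)
| polynomial_coord i : polynomial_function (fun x => x 0 i)
| polynomialD f g : polynomial_function f -> polynomial_function g ->
    polynomial_function (fun x => f x + g x)
| polynomialM f g : polynomial_function f -> polynomial_function g ->
    polynomial_function (fun x => f x * g x).

Lemma polynomial_sum n (I : Type) (s : seq I) (P : pred I) (F : I -> 'rV[R]_n -> R) :
  (forall i, polynomial_function (F i)) ->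
  polynomial_function (fun x => \sum_(i <- s | P i) F i x).
Proof.
move=> pF; elim: s => [|i s IH].
  by under eq_fun do rewrite big_nil; exact: polynomial_cst.
by under eq_fun do rewrite big_cons; case: (P i) => //; exact: polynomialD.
Qed.

Lemma polynomial_prod n (I : Type) (s : seq I) (F : I -> 'rV[R]_n -> R) :
  (forall i, polynomial_function (F i)) ->
  polynomial_function (fun x => \prod_(i <- s) F i x).
Proof.
move=> pF; elim: s => [|i s IH].
  by under eq_fun do rewrite big_nil; exact: polynomial_cst.
by under eq_fun do rewrite big_cons; exact: polynomialM.
Qed.

Lemma polynomialX n (f : 'rV[R]_n -> R) m :
  polynomial_function f -> polynomial_function (fun x => f x ^+ m).
Proof.
move=> pf; elim: m => [|m IH]; first exact: polynomial_cst.
by under eq_fun do rewrite exprS; exact: polynomialM.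
Qed.

Lemma polynomial_comp m n (f : 'rV[R]_n -> R) (g : 'rV[R]_m -> 'rV[R]_n) :
  (forall i, polynomial_function (fun t => g t 0 i)) ->
  polynomial_function f -> polynomial_function (f \o g).
Proof.
move=> pg; elim=> {f} [c|i|f f' _ IH _ IH'|f f' _ IH _ IH'].
- exact: polynomial_cst.
- exact: pg.
- exact: polynomialD IH IH'.
- exact: polynomialM IH IH'.
Qed.

(** Restriction to lines turns partial derivatives into formal derivatives in [{poly R}], and allows
    vanishing to be proved by counting roots. *)
Lemma polynomial_line n (f : 'rV[R]_n -> R) (x v : 'rV[R]_n) :
  polynomial_function f -> exists p : {poly R}, forall t, f (x + t *: v) = p.[t].
Proof.
elim=> {f} [c|i|f g _ [p fp] _ [q gq]|f g _ [p fp] _ [q gq]].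
- by exists c%:P => t; rewrite hornerC.
- exists ((x 0 i)%:P + (v 0 i) *: 'X) => t.
  by rewrite !hornerE !mxE mulrC.
- by exists (p + q) => t; rewrite fp gq hornerD.
- by exists (p * q) => t; rewrite fp gq hornerM.
Qed.

Lemma partial_line n (f : 'rV[R]_n -> R) i x (p : {poly R}) :
  (forall t, f (x + t *: delta_mx 0 i) = p.[t]) -> partial i f x = p^`().[0].
Proof.
move=> fp; rewrite /partial.
have -> : (fun t : R => f (x + t *: delta_mx 0 i)) = horner p by apply/funext.
exact: (congr1 (@^~ 0) (esym (derivE p))).
Qed.

Lemma partialD n (f g : 'rV[R]_n -> R) i :
  polynomial_function f -> polynomial_function g ->
  partial i (fun x => f x + g x) = (fun x => partial i f x + partial i g x).
Proof.
move=> pf pg; apply/funext => x.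
have [p fp] := polynomial_line x (delta_mx 0 i) pf.
have [q gq] := polynomial_line x (delta_mx 0 i) pg.
rewrite (partial_line fp) (partial_line gq) (@partial_line _ _ _ _ (p + q)).
  by rewrite derivD hornerD.
by move=> t; rewrite fp gq hornerD.
Qed.

Lemma partialM n (f g : 'rV[R]_n -> R) i :
  polynomial_function f -> polynomial_function g ->
  partial i (fun x => f x * g x) =
  (fun x => partial i f x * g x + f x * partial i g x).
Proof.
move=> pf pg; apply/funext => x.
have [p fp] := polynomial_line x (delta_mx 0 i) pf.
have [q gq] := polynomial_line x (delta_mx 0 i) pg.
rewrite (partial_line fp) (partial_line gq) (@partial_line _ _ _ _ (p * q)).
  have := fp 0; have := gq 0; rewrite scale0r addr0 => -> ->.
  by rewrite derivM hornerD !hornerM.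
by move=> t; rewrite fp gq hornerM.
Qed.

Lemma partial_cst n (c : R) (i : 'I_n) : partial i (fun=> c) = fun=> 0.
Proof.
apply/funext => x; rewrite (@partial_line _ _ _ _ c%:P) ?derivC ?horner0//.
by move=> t; rewrite hornerC.
Qed.

Lemma polynomial_partial n (f : 'rV[R]_n -> R) i :
  polynomial_function f -> polynomial_function (partial i f).
Proof.
elim=> {f} [c|j|f g pf IH pg IH'|f g pf IH pg IH'].
- by rewrite partial_cst; exact: polynomial_cst.
- rewrite (_ : partial _ _ = fun=> (delta_mx 0 i : 'rV[R]_n) 0 j).
    exact: polynomial_cst.
  apply/funext => x.
  rewrite (@partial_line _ _ _ _ ((x 0 j)%:P + (delta_mx 0 i : 'rV[R]_n) 0 j *: 'X)).
    by rewrite derivD derivC derivZ derivX !hornerE.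
  by move=> t; rewrite !hornerE !mxE mulrC.
- by rewrite partialD//; exact: polynomialD.
- by rewrite partialM//; apply: polynomialD; apply: polynomialM.
Qed.

Lemma polynomial_continuous n (f : 'rV[R]_n -> R) :
  polynomial_function f -> continuous f.
Proof.
elim=> {f} [c|j|f g _ IH _ IH'|f g _ IH _ IH'] x.
- exact: cst_continuous.
- exact: coord_continuous.
- exact: (continuousD (IH x) (IH' x)).
- exact: (continuousM (IH x) (IH' x)).
Qed.

Lemma polynomial_measurable n (f : 'rV[R]_n -> R) :
  polynomial_function f -> measurable_fun setT f.
Proof.
elim=> {f} [c|j|f g _ IH _ IH'|f g _ IH _ IH'].
- exact: measurable_cst.
- exact: measurable_coord.
- exact: measurable_funD.
- exact: measurable_funM.
Qed.

Lemma polynomial_bounded_measurable n (f : 'rV[R]_n -> R) (D : set 'rV[R]_n) (B : R) :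
  (forall x, D x -> forall i, `|x 0 i| <= B) ->
  polynomial_function f -> bounded_measurable D f.
Proof.
move=> DB; elim=> {f} [c|j|f g _ IH _ IH'|f g _ IH _ IH'].
- exact: bounded_measurable_cst.
- split; last by exists B => x /DB.
  by apply: measurable_funTS; exact: measurable_coord.
- exact: bounded_measurableD.
- exact: bounded_measurableM.
Qed.

(** If [f] were nonzero at a point of [D], then by continuity [f ^ 2] would exceed a positive
    constant on a box inside [D], which has positive measure. So [f] vanishes on the open set [D],
    and a polynomial vanishing on a nonempty open set is zero. *)
Lemma polynomial_Rintegral_sqr_eq0 n (f : 'rV[R]_n -> R) (D : set 'rV[R]_n) (B : R) :
  polynomial_function f -> measurable D -> open D -> D !=set0 ->
  (forall x, D x -> forall i, `|x 0 i| <= B) ->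
  \int[@leb R n]_(x in D) (f x * f x) = 0 -> f = fun=> 0.
Proof.
move=> pf mD oD [x0 Dx0] DB int0.
have bDf : bounded_measurable D (fun x => f x * f x).
  by apply: (polynomial_bounded_measurable DB); exact: polynomialM.
have muD := leb_bounded_lty mD DB.
have f0D x : D x -> f x = 0.
  move=> Dx; apply/eqP/negPn/negP => fx0.
  have fp : 0 < f x * f x by rewrite -expr2 exprn_even_gt0.
  pose e := f x * f x / 2.
  have e0 : 0 < e by rewrite divr_gt0.
  have pff := polynomialM pf pf.
  have : nbhs x (D `&` [set y | e < f y * f y]).
    apply: filterI; first by apply: open_nbhs_nbhs; split.
    apply: (cvgr_gt _ (polynomial_continuous pff (x := x))).
    by rewrite /e ltr_pdivrMr// mulr2n mulrDr mulr1 ltrDl.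
  move=> /nbhs_ballP[r /= r0 rD].
  have boxD : box x r `<=` D `&` [set y | e < f y * f y].
    move=> y xy; apply: rD; split => // i j; rewrite !ord1; exact: xy.
  have mb := measurable_box x r.
  have b1 : \int[@leb R n]_(y in box x r) e <= \int[@leb R n]_(y in D) (f y * f y).
    have bboxf : bounded_measurable (box x r) (fun y => f y * f y).
      split; first by apply: measurable_funTS; exact: polynomial_measurable pff.
      by case: bDf => _ [C fC]; exists C => y /boxD[/fC].
    have boxlt : (@leb R n (box x r) < +oo)%E by rewrite leb_box ?ltry// ltW.
    apply: (@le_trans _ _ (\int[@leb R n]_(y in box x r) (f y * f y))).
      apply: le_Rintegral => //.
      - by apply: bounded_measurable_integrable => //; exact: bounded_measurable_cst.
      - exact: bounded_measurable_integrable.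
      - by move=> y /boxD[_ /ltW].
    rewrite /Rintegral fine_le//.
    - by apply: integrable_fin_num => //; exact: bounded_measurable_integrable.
    - by apply: integrable_fin_num => //; exact: bounded_measurable_integrable.
    apply: ge0_subset_integral => //.
    - by apply/measurable_EFinP; case: bDf.
    - by move=> y _; rewrite lee_fin -expr2 sqr_ge0.
    - by move=> y /boxD[].
  move: b1; rewrite int0 Rintegral_cst//.
  rewrite (_ : fine _ = (r *+ 2) ^+ n); last first.
    exact: (congr1 fine (leb_box x (ltW r0))).
  rewrite leNgt => /negP; apply.
  by rewrite mulr_gt0// exprn_gt0// mulrn_wgt0.
(* From [D] to the whole space: on the line from [x0] to [y], the function is a univariate
   polynomial that vanishes for all small parameters. *)
apply/funext => y.
have [p fp] := polynomial_line x0 (y - x0) pf.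
suff p0 : p = 0 by have := fp 1; rewrite p0 horner0 scale1r addrC subrK.
have : nbhs (0 : R) (fun t : R => D (x0 + t *: (y - x0))).
  have lc : {for 0, continuous (fun t : R => x0 + t *: (y - x0))}.
    apply: continuousD; first exact: cst_continuous.
    by apply: scalel_continuous.
  by apply: (lc D); rewrite scale0r addr0; exact: open_nbhs_nbhs.
move=> /nbhs_ballP[r /= r0 rD].
have roots t : `|t| < r -> root p t.
  move=> tr; apply/rootP; rewrite -fp; apply: f0D; apply: rD.
  by rewrite /ball /= sub0r normrN.
apply/eqP/negPn/negP => p0.
(* These are [size p] distinct roots, too many for a nonzero [p]. The shift [i.+2] keeps them
   strictly below [r]. *)
pose rs := [seq r / (i.+2)%:R | i <- iota 0 (size p)].
suff : (size rs < size p)%N by rewrite size_map size_iota ltnn.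
apply: max_poly_roots => //.
- apply/allP => _ /mapP[i _ ->]; apply: roots.
  rewrite ger0_norm ?divr_ge0 ?ltW// ltr_pdivrMr// ltr_pMr//.
  by rewrite ltr1n.
- rewrite map_inj_uniq ?iota_uniq// => i j /(mulfI (lt0r_neq0 r0))/invr_inj/eqP.
  by rewrite eqr_nat => /eqP[].
Qed.

End polynomial_functions.

(** * The spaces [Pol] and [Gr] and the divergence *)

Section polynomial_spaces.
Context {R : realType} {d : nat}.
Implicit Types (f g : 'rV[R]_d -> R).

Lemma dotE (u v : 'rV[R]_d) : dot u v = \sum_i u 0 i * v 0 i.
Proof. by rewrite /dot mxE; apply: eq_bigr => i _; rewrite mxE. Qed.

(** The degree condition is moved into the function: a multi-index rejected by [D] gives the zero
    function, so that sums run over the whole finite type of multi-indices. *)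
Definition monomial m (D : pred nat) (a : {ffun 'I_d -> 'I_m.+1}) (x : 'rV[R]_d) : R :=
  if D (\sum_i a i)%N then \prod_i x 0 i ^+ a i else 0.

Lemma poly_fun_monomial m (D : pred nat) (c : {ffun 'I_d -> 'I_m.+1} -> R) x :
  poly_fun D c x = \sum_a c a * monomial D a x.
Proof.
rewrite /poly_fun big_mkcond; apply: eq_bigr => a _; rewrite /monomial.
by case: ifP => //; rewrite mulr0.
Qed.

Lemma polynomial_monomial m (D : pred nat) (a : {ffun 'I_d -> 'I_m.+1}) :
  polynomial_function (monomial D a).
Proof.
rewrite /monomial; case: (D _); last exact: polynomial_cst.
by apply: polynomial_prod => i; apply: polynomialX; exact: polynomial_coord.
Qed.

Lemma Pol_polynomial m f : Pol m f -> polynomial_function f.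
Proof.
move=> [c _ <-]; rewrite (_ : poly_fun _ _ = fun x => \sum_a c a *
    monomial (fun e => (e <= m)%N) a x); last first.
  by apply/funext => x; exact: poly_fun_monomial.
apply: polynomial_sum => a; apply: polynomialM; first exact: polynomial_cst.
exact: polynomial_monomial.
Qed.

Lemma Pol_linear m (a : R) f g : Pol m f -> Pol m g ->
  Pol m (fun x => a * f x + g x).
Proof.
move=> [c _ <-] [c' _ <-]; exists (fun e => a * c e + c' e) => //.
apply/funext => x; rewrite !poly_fun_monomial mulr_sumr -big_split.
by apply: eq_bigr => e _; rewrite mulrDl mulrA.
Qed.

(* In the definition of [Gr], [q x] is coerced to a function of two indices. *)
Lemma GrE r s (q : 'rV[R]_d -> 'rV[R]_d) : Gr r s q <->
  if s == r then exists (p : 'rV[R]_d -> 'rV[R]_d) m,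
    [/\ forall i, Pol r (fun x => p x 0 i), hPol r m &
       forall x, q x = p x + m x *: x]
  else forall i, Pol r.+1 (fun x => q x 0 i).
Proof.
rewrite /Gr; case: eqP => // _; split => -[p [m [Pp hm qpm]]].
  exists (fun x => \row_i p x 0 i), m; split => // [i|x].
    by under eq_fun do rewrite mxE; exact: Pp.
  apply/rowP => i; rewrite !mxE.
  have -> : q x 0 i = p x 0 i + (m x *: x) 0 i := congr1 (fun h => h 0 i) (qpm x).
  by rewrite mxE.
hnf; exists (fun x => fun_of_matrix (p x)), m; split => // x.
by apply/funext => i; apply/funext => j; rewrite qpm mxE.
Qed.

(** A finite spanning family of polynomial fields treats the Raviart-Thomas and
    Brezzi-Douglas-Marini spaces alike, and makes the discrete weak gradient the solution of a
    finite linear system. The family need not be a basis. *)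
Lemma Gr_span_fin r s : exists (I : finType) (E : I -> 'rV[R]_d -> 'rV[R]_d),
  (forall k i, polynomial_function (fun x => E k x 0 i)) /\
  forall q, Gr r s q <-> exists c : I -> R, q = fun x => \sum_k c k *: E k x.
Proof.
pose V m (k : 'I_d * {ffun 'I_d -> 'I_m.+1}) (x : 'rV[R]_d) : 'rV[R]_d :=
  monomial (fun e => (e <= m)%N) k.2 x *: delta_mx 0 k.1.
have Vcoord m (c : 'I_d * {ffun 'I_d -> 'I_m.+1} -> R) x i :
    (\sum_k c k *: V m k x) 0 i = poly_fun (fun e => (e <= m)%N) (fun a => c (i, a)) x.
  rewrite poly_fun_monomial summxE.
  transitivity (\sum_j \sum_a (c (j, a) *: V m (j, a) x) 0 i).
    by rewrite pair_bigA; apply: eq_bigr => -[].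
  rewrite (bigD1 i)//= [X in _ + X]big1 ?addr0; last first.
    by move=> j ji; apply: big1 => a _; rewrite !mxE/= eq_sym (negbTE ji) !mulr0.
  by apply: eq_bigr => a _; rewrite !mxE !eqxx mulr1.
have VP m (p : 'rV[R]_d -> 'rV[R]_d) : (forall i, Pol m (fun x => p x 0 i)) ->
    exists c, p = fun x => \sum_k c k *: V m k x.
  move=> Pp; have [c pc] := choice (fun i => let: ex_intro2 c _ pc := Pp i in
    ex_intro (fun c => poly_fun (fun e => (e <= m)%N) c = (fun x => p x 0 i)) c pc).
  exists (fun k => c k.1 k.2); apply/funext => x; apply/rowP => i.
  by rewrite Vcoord/= -[RHS]/(poly_fun _ (c i) x) pc.
have PV m (k : 'I_d * {ffun 'I_d -> 'I_m.+1}) i :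
    polynomial_function (fun x => V m k x 0 i).
  under eq_fun do rewrite /V !mxE.
  apply: polynomialM; last exact: polynomial_cst.
  exact: polynomial_monomial.
case: eqP (@GrE r s) => _ GE; last first.
  exists ('I_d * {ffun 'I_d -> 'I_r.+2})%type, (V r.+1); split => // q; rewrite GE; split.
    exact: VP.
  move=> [c ->] i /=; exists (fun a => c (i, a)) => //.
  by apply/funext => x; rewrite Vcoord.
(* Raviart-Thomas case: the left summand indexes the fields with components in [Pol r], the right
   one the homogeneous monomials multiplied by [x]. *)
exists ('I_d * {ffun 'I_d -> 'I_r.+1} + {ffun 'I_d -> 'I_r.+1})%type.
exists (fun k x => match k with inl k => V r k x
  | inr a => monomial (fun e => e == r) a x *: x end); split.
  move=> [k|a] i //; under eq_fun do rewrite !mxE.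
  apply: polynomialM; last exact: polynomial_coord.
  exact: polynomial_monomial.
move=> q; rewrite GE; split => [[p [m [Pp [c' _ mc] qpm]]]|[c qc]].
  have [c pc] := VP _ _ Pp.
  exists (fun k => match k with inl k => c k | inr a => c' a end).
  apply/funext => x; rewrite qpm pc -mc poly_fun_monomial big_sumType/=.
  by rewrite scaler_suml; congr (_ + _); apply: eq_bigr => a _; rewrite scalerA.
exists (fun x => \sum_k c (inl k) *: V r k x).
exists (poly_fun (fun e => e == r) (fun a => c (inr a))); split.
- by move=> i; exists (fun a => c (inl (i, a))) => //; apply/funext => x; rewrite Vcoord.
- by exists (fun a => c (inr a)).
move=> x; rewrite qc big_sumType/= poly_fun_monomial scaler_suml; congr (_ + _).
by apply: eq_bigr => a _; rewrite scalerA.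
Qed.

Lemma Gr_span r s : exists n (E : 'I_n -> 'rV[R]_d -> 'rV[R]_d),
  (forall k i, polynomial_function (fun x => E k x 0 i)) /\
  forall q, Gr r s q <-> exists c : 'I_n -> R, q = fun x => \sum_k c k *: E k x.
Proof.
have [I [E [pE GE]]] := Gr_span_fin r s.
exists #|I|, (E \o enum_val); split => [k i|q]; first exact: pE.
rewrite GE; split=> -[c ->].
  exists (c \o enum_val); apply/funext => x.
  exact: reindex (onW_bij _ (enum_val_bij I)).
exists (c \o enum_rank); apply/funext => x.
rewrite (reindex _ (onW_bij _ (enum_val_bij I)))/=.
by apply: eq_bigr => k _; rewrite enum_valK.
Qed.

Lemma Gr_polynomial r s (q : 'rV[R]_d -> 'rV[R]_d) i :
  Gr r s q -> polynomial_function (fun x => q x 0 i).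
Proof.
have [n [E [pE GE]]] := Gr_span r s; move=> /GE[c ->].
under eq_fun do rewrite summxE; apply: polynomial_sum => k.
under eq_fun do rewrite mxE.
by apply: polynomialM; [exact: polynomial_cst|exact: pE].
Qed.

Lemma Gr_linear r s (a : R) (p q : 'rV[R]_d -> 'rV[R]_d) :
  Gr r s p -> Gr r s q -> Gr r s (fun x => a *: p x + q x).
Proof.
have [n [E [pE GE]]] := Gr_span r s; move=> /GE[c ->] /GE[c' ->]; apply/GE.
exists (fun k => a * c k + c' k); apply/funext => x.
rewrite scaler_sumr -big_split; apply: eq_bigr => k _.
by rewrite /= scalerDl scalerA.
Qed.

Lemma partial_sum n (c : 'I_n -> R) (F : 'I_n -> 'rV[R]_d -> R) i :
  (forall k, polynomial_function (F k)) ->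
  partial i (fun x => \sum_k c k * F k x) = fun x => \sum_k c k * partial i (F k) x.
Proof.
move=> pF; elim: (index_enum _) => [|k ks IH].
  rewrite (_ : (fun x => _) = (fun=> 0)); last by apply/funext => x; rewrite big_nil.
  by rewrite partial_cst; apply/funext => x; rewrite big_nil.
rewrite (_ : (fun x => _) = (fun x => c k * F k x + \sum_(j <- ks) c j * F j x)).
  have pc := @polynomial_cst R d (c k).
  rewrite partialD; [|exact: polynomialM|]; last first.
    by apply: polynomial_sum => j; apply: polynomialM => //; exact: polynomial_cst.
  rewrite partialM//; apply/funext => x.
  by rewrite big_cons partial_cst mul0r add0r IH.
by apply/funext => x; rewrite big_cons.
Qed.

Lemma divergence_sum n (c : 'I_n -> R) (F : 'I_n -> 'rV[R]_d -> 'rV[R]_d) :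
  (forall k i, polynomial_function (fun x => F k x 0 i)) ->
  divergence (fun x => \sum_k c k *: F k x) = fun x => \sum_k c k * divergence (F k) x.
Proof.
move=> pF; apply/funext => x; rewrite /divergence.
under eq_bigr => i _.
  rewrite (_ : (fun y => _) = fun y => \sum_k c k * F k y 0 i); last first.
    by apply/funext => y; rewrite summxE; apply: eq_bigr => k _; rewrite mxE.
  rewrite (partial_sum _ _ (pF^~ i)); over.
by rewrite exchange_big; apply: eq_bigr => k _; rewrite mulr_sumr.
Qed.

Lemma polynomial_divergence (q : 'rV[R]_d -> 'rV[R]_d) :
  (forall i, polynomial_function (fun x => q x 0 i)) ->
  polynomial_function (divergence q).
Proof. by move=> pq; apply: polynomial_sum => i; exact: polynomial_partial. Qed.

Lemma polynomial_dot (p q : 'rV[R]_d -> 'rV[R]_d) :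
  (forall i, polynomial_function (fun x => p x 0 i)) ->
  (forall i, polynomial_function (fun x => q x 0 i)) ->
  polynomial_function (fun x => dot (p x) (q x)).
Proof.
move=> pp pq; under eq_fun do rewrite dotE.
by apply: polynomial_sum => i; exact: polynomialM.
Qed.

Lemma polynomial_dot_cst (q : 'rV[R]_d -> 'rV[R]_d) (nu : 'rV[R]_d) :
  (forall i, polynomial_function (fun x => q x 0 i)) ->
  polynomial_function (fun x => dot (q x) nu).
Proof. by move=> pq; apply: polynomial_dot => // i; exact: polynomial_cst. Qed.

End polynomial_spaces.

(** * Geometry of the cells through barycentric coordinates *)

Section mesh_cells.
Context {R : realType} {d : nat} (M : mesh R d).
Implicit Types (K F : {set node M}).

(** The rows are the homogeneous coordinates of the vertices, so that affine independence becomes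
    linear independence of rows. *)
Definition vertex_mx K : 'M[R]_(#|K|, 1 + d) :=
  \matrix_(i < #|K|) row_mx (1 : 'rV[R]_1) (pos (enum_val i)).

(** The matrix is square only through the equation [#|K| = d.+1], hence a pseudo-inverse, which is a
    two-sided inverse on the cells. *)
Definition barycentric K (x : 'rV[R]_d) : 'rV[R]_#|K| :=
  row_mx (1 : 'rV[R]_1) x *m pinvmx (vertex_mx K).

Lemma mul_vertex_mx K (t : node M -> R) :
  (\row_i t (enum_val i)) *m vertex_mx K =
  row_mx (\sum_(p in K) t p)%:M (\sum_(p in K) t p *: pos p).
Proof.
have enumE (V : nmodType) (f : node M -> V) :
    \sum_(p in K) f p = \sum_(i < #|K|) f (enum_val i) by exact: big_enum_val.
rewrite mulmx_sum_row !enumE.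
rewrite (_ : (\sum_i t (enum_val i))%:M = \sum_i t (@enum_val _ K i) *: (1 : 'rV[R]_1)).
  elim: (index_enum _) => [|i s IH]; first by rewrite !big_nil row_mx0.
  by rewrite !big_cons IH mxE rowK scale_row_mx add_row_mx.
apply/rowP => i; rewrite !mxE summxE ord1 mulr1n.
by apply: eq_bigr => j _; rewrite !mxE mulr1.
Qed.

Lemma row_of_enum K (v : 'rV[R]_#|K|) :
  exists t : node M -> R, v = \row_i t (enum_val i).
Proof.
exists (fun p => \sum_(i | enum_val i == p) v 0 i); apply/rowP => i.
rewrite mxE (big_pred1 i)// => j; exact: (inj_eq enum_val_inj).
Qed.

Lemma vertex_mx_free K : affinely_independent K -> row_free (vertex_mx K).
Proof.
move=> aff; apply: inj_row_free => v; have [t ->] := row_of_enum v.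
rewrite mul_vertex_mx -[0 in RHS]row_mx0 => /eq_row_mx[t0 tp0].
apply/rowP => i; rewrite !mxE; apply: aff => //; last exact: enum_valP.
by have := congr1 (fun A : 'rV_1 => A 0 0) t0; rewrite !mxE mulr1n.
Qed.

Hypothesis (K : {set node M}) (cardK : #|K| = d.+1) (affK : affinely_independent K).

(** Row freeness recovers the weights from the point, and full rank makes every point an affine
    combination of the vertices. A finite intersection of strict inequalities between affine
    functions is then both measurable and open. *)
Lemma open_simplex_barycentric :
  open_simplex K = \bigcap_i [set x | 0 < barycentric K x 0 i].
Proof.
have freeK := vertex_mx_free affK.
have fullK : row_full (vertex_mx K).
  by rewrite /row_full (eqP freeK) cardK.
have one_scalar (a : R) : a = 1 -> a%:M = 1 :> 'rV[R]_1 by move=> ->.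
apply/seteqP; split => x.
  move=> [t [tpos t1 xt]] i _ /=.
  rewrite /barycentric [X in row_mx _ X]xt -(one_scalar _ t1) -mul_vertex_mx.
  by rewrite mulmxKp// mxE; apply: tpos; exact: enum_valP.
move=> /= bpos; have [t bt] := row_of_enum (barycentric K x).
have : barycentric K x *m vertex_mx K = row_mx (1 : 'rV[R]_1) x.
  by rewrite /barycentric -mulmxA mulVpmx// mulmx1.
rewrite bt mul_vertex_mx => /eq_row_mx[t1 tx].
exists t; split => //.
  move=> p pK; have := bpos (enum_rank_in pK p) Logic.I.
  by rewrite /= bt mxE enum_rankK_in.
by have := congr1 (fun A : 'rV_1 => A 0 0) t1; rewrite !mxE mulr1n.
Qed.

Lemma polynomial_barycentric i : polynomial_function (fun x => barycentric K x 0 i).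
Proof.
rewrite /barycentric; under eq_fun do rewrite mxE.
apply: polynomial_sum => j; apply: polynomialM; last exact: polynomial_cst.
case: (split_ordP j) => l ->.
  by under eq_fun do rewrite row_mxEl; exact: polynomial_cst.
by under eq_fun do rewrite row_mxEr; exact: polynomial_coord.
Qed.

Lemma measurable_open_simplex : measurable (open_simplex K).
Proof.
rewrite open_simplex_barycentric; apply: fin_bigcap_measurable => // i _.
rewrite -[X in measurable X]setTI.
apply: (polynomial_measurable (polynomial_barycentric i) measurableT (Y := [set y | 0 < y])).
by apply: open_measurable; exact: open_gt.
Qed.

Lemma open_open_simplex : open (open_simplex K).
Proof.
rewrite open_simplex_barycentric openE => x xK.
suff : \forall y \near x, forall i, 0 < barycentric K y 0 i.
  by apply: filterS => y yK i _; exact: yK.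
apply: (@filter_forall _ _ (fun i y => 0 < barycentric K y 0 i) (nbhs x)) => i.
apply: (cvgr_gt _ (polynomial_continuous (polynomial_barycentric i) (x := x))).
exact: xK.
Qed.

Lemma open_simplex_nonempty : open_simplex K !=set0.
Proof.
(* The barycentre, with all [d.+1] weights equal. *)
exists (\sum_(p in K) (d.+1%:R^-1) *: pos p); exists (fun=> d.+1%:R^-1); split => //.
by rewrite sumr_const cardK -[LHS]mulr_natr mulVf.
Qed.

Lemma open_simplex_bounded : exists B : R, forall x, open_simplex K x ->
  forall i, `|x 0 i| <= B.
Proof.
exists (\sum_(p in K) \sum_i `|pos p 0 i|) => x [t [tpos t1 ->]] i.
rewrite summxE; apply: (le_trans (ler_norm_sum _ _ _)); apply: ler_sum => p pK.
rewrite mxE normrM (ger0_norm (ltW (tpos p pK))) (bigD1 i)//=.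
have tp1 : t p <= 1.
  rewrite -t1 (bigD1 p)//= lerDl; apply: sumr_ge0 => q /andP[qK _].
  exact: ltW (tpos q qK).
apply: (@le_trans _ _ `|pos p 0 i|); first by rewrite ler_piMl.
by rewrite lerDl sumr_ge0.
Qed.

End mesh_cells.

(** The Fredholm alternative: the columns of [cokermx G] lie in the kernel of [G], and [L] is in the
    row space as soon as it annihilates them. *)
Lemma row_orthogonal_kernel (F : fieldType) n (G : 'M[F]_n) (L : 'rV[F]_n) :
  (forall y : 'cV[F]_n, G *m y = 0 -> L *m y = 0) -> exists c : 'rV[F]_n, c *m G = L.
Proof.
move=> kerGL; suff /submxP[c ->] : (L <= G)%MS by exists c.
rewrite submxE; apply/eqP/matrixP => i j.
have /kerGL/matrixP/(_ i 0) : G *m col j (cokermx G) = 0.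
  by rewrite colE mulmxA mulmx_coker mul0mx.
by rewrite colE mulmxA -colE mxE => ->; rewrite !mxE.
Qed.

(** * Integrals over cells and faces *)

Section cell_integrals.
Context {R : realType} {d : nat} (Omega : set 'rV[R]_d) (M : mesh R d).
Hypothesis hM : is_mesh M Omega.
Implicit Types (f g : 'rV[R]_d -> R) (q : 'rV[R]_d -> 'rV[R]_d).

Section one_cell.
Variable K : {set node M}.
Hypothesis hK : K \in cells M.

Lemma measurable_cell : measurable (open_simplex K).
Proof. by case: hM => /(_ _ hK)[cK aK _] _ _; exact: measurable_open_simplex. Qed.

Lemma polynomial_cell f : polynomial_function f -> bounded_measurable (open_simplex K) f.
Proof.
case: hM => /(_ _ hK)[cK aK _] _ _.
by have [B KB] := open_simplex_bounded K; exact: polynomial_bounded_measurable KB.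
Qed.

Lemma leb_cell_lty : (@leb R d (open_simplex K) < +oo)%E.
Proof.
have [B KB] := open_simplex_bounded K.
exact: leb_bounded_lty measurable_cell KB.
Qed.

Lemma cell_int_linear (a : R) f g :
  bounded_measurable (open_simplex K) f -> bounded_measurable (open_simplex K) g ->
  cell_int K (fun x => a * f x + g x) = a * cell_int K f + cell_int K g.
Proof.
move=> bf bg; have mK := measurable_cell; have ltK := leb_cell_lty.
rewrite /cell_int RintegralD_bounded// ?RintegralZl_bounded//.
by apply: bounded_measurableM => //; exact: bounded_measurable_cst.
Qed.

Lemma cell_int_sum n (c : 'I_n -> R) (F : 'I_n -> 'rV[R]_d -> R) :
  (forall k, bounded_measurable (open_simplex K) (F k)) ->
  cell_int K (fun x => \sum_k c k * F k x) = \sum_k c k * cell_int K (F k).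
Proof.
move=> bF; apply: Rintegral_sum_bounded => //; first exact: measurable_cell.
exact: leb_cell_lty.
Qed.

(** The integrals of the squared components are non-negative with sum zero, so each vanishes, and
    the cell is open and nonempty. Being polynomial, [q] vanishes on the whole space and not only on
    the cell. *)
Lemma cell_int_dot_eq0 q : (forall i, polynomial_function (fun x => q x 0 i)) ->
  cell_int K (fun x => dot (q x) (q x)) = 0 -> q = fun=> 0.
Proof.
move=> pq q0.
have sum0 : \sum_i cell_int K (fun x => q x 0 i * q x 0 i) = 0.
  under eq_bigr do rewrite -[cell_int _ _]mul1r.
  rewrite -cell_int_sum; last by move=> i; apply: polynomial_cell; exact: polynomialM.
  rewrite -[RHS]q0; congr (cell_int K _); apply/funext => x; rewrite dotE.
  by apply: eq_bigr => i _; rewrite mul1r.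
have ge0 i : 0 <= cell_int K (fun x => q x 0 i * q x 0 i).
  by apply: Rintegral_ge0 => x _; rewrite -expr2 sqr_ge0.
have eq0 i : cell_int K (fun x => q x 0 i * q x 0 i) = 0.
  move/eqP: sum0; rewrite psumr_eq0 => [|j _]; last exact: ge0.
  by move/allP/(_ i (mem_index_enum _))/eqP.
have [B KB] := open_simplex_bounded K.
case: hM => /(_ _ hK)[cK aK _] _ _.
apply/funext => x; apply/rowP => i; rewrite mxE.
have := polynomial_Rintegral_sqr_eq0 (pq i) measurable_cell
  (open_open_simplex cK aK) (open_simplex_nonempty cK) KB (eq0 i).
by move/(congr1 (@^~ x)).
Qed.

End one_cell.

Section one_face.
Variable F : {set node M}.

Let ref_bounded (t : 'rV[R]_d.-1) : ref_simplex t -> forall i, `|t 0 i| <= 1.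
Proof.
move=> [t0 t1] i; rewrite ger0_norm//; apply: le_trans t1.
by rewrite (bigD1 i)//= lerDl sumr_ge0.
Qed.

Lemma measurable_ref_simplex : measurable (@ref_simplex R d).
Proof.
rewrite (_ : ref_simplex = (\bigcap_i [set t : 'rV[R]_d.-1 | 0 <= t 0 i]) `&`
    [set t : 'rV[R]_d.-1 | \sum_i t 0 i <= 1]); last first.
  by apply/seteqP; split => t [t0 t1]; split; [move=> i _; exact: t0|exact: t1|
    move=> i; exact: t0|exact: t1].
apply: measurableI.
  apply: fin_bigcap_measurable => // i _; rewrite -[X in measurable X]setTI.
  apply: (measurable_coord i measurableT (Y := [set y | 0 <= y])).
  by apply: closed_measurable; exact: closed_ge.
rewrite -[X in measurable X]setTI.
have ps : polynomial_function (fun t : 'rV[R]_d.-1 => \sum_i t 0 i).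
  by apply: polynomial_sum => i; exact: polynomial_coord.
apply: (polynomial_measurable ps measurableT (Y := [set y | y <= 1])).
by apply: closed_measurable; exact: closed_le.
Qed.

Let leb_ref_lty : (@leb R d.-1 ref_simplex < +oo)%E.
Proof. exact: leb_bounded_lty measurable_ref_simplex ref_bounded. Qed.

(** The parametrisation [face_param] is affine, so polynomials pull back to polynomials on the
    bounded reference simplex. *)
Let polynomial_face f : polynomial_function f ->
  bounded_measurable ref_simplex (f \o face_param F).
Proof.
move=> pf; apply: (polynomial_bounded_measurable ref_bounded).
apply: polynomial_comp => // i; under eq_fun do rewrite mxE summxE.
apply: polynomialD; first exact: polynomial_cst.
apply: polynomial_sum => j; under eq_fun do rewrite mxE.
by apply: polynomialM; [exact: polynomial_coord|exact: polynomial_cst].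
Qed.

Lemma face_int_linear (a : R) f g : polynomial_function f -> polynomial_function g ->
  face_int F (fun x => a * f x + g x) = a * face_int F f + face_int F g.
Proof.
move=> /polynomial_face bf /polynomial_face bg; have mr := measurable_ref_simplex.
rewrite /face_int RintegralD_bounded// ?RintegralZl_bounded//.
  by rewrite mulrDr mulrCA.
by apply: bounded_measurableM => //; exact: bounded_measurable_cst.
Qed.

Lemma face_int_sum n (c : 'I_n -> R) (G : 'I_n -> 'rV[R]_d -> R) :
  (forall k, polynomial_function (G k)) ->
  face_int F (fun x => \sum_k c k * G k x) = \sum_k c k * face_int F (G k).
Proof.
move=> pG; rewrite /face_int (Rintegral_sum_bounded measurable_ref_simplex)//.
  by rewrite mulr_sumr; apply: eq_bigr => k _; rewrite mulrCA.
by move=> k; exact: polynomial_face.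
Qed.

End one_face.
End cell_integrals.

(** * Well-posedness and linearity of the discrete weak gradient *)

Section weak_gradient.
Context {R : realType} {d : nat} (Omega : set 'rV[R]_d) (M : mesh R d) (r s : nat).
Hypothesis hM : is_mesh M Omega.
Implicit Types (u v : wg M) (q g : 'rV[R]_d -> 'rV[R]_d).

Variable K : {set node M}.
Hypothesis hK : K \in cells M.

(** The right-hand side of the equation that defines the weak gradient, isolated because it is
    linear in [v] and in [q] separately. *)
Definition weak_divergence v q : R :=
  - cell_int K (fun x => v.1 K x * divergence q x) +
  \sum_(F in faces_of K)
    face_int F (fun x => v.2 F x * dot (q x) (outward_normal K F)).

Lemma wg_cellE (a : R) u v L :
  (a *: u + v).1 L = fun x => a * u.1 L x + v.1 L x.
Proof. by []. Qed.

Lemma wg_faceE (a : R) u v F :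
  (a *: u + v).2 F = fun x => a * u.2 F x + v.2 F x.
Proof. by []. Qed.

Lemma Vh_linear (a : R) u v :
  Vh Omega r s u -> Vh Omega r s v -> Vh Omega r s (a *: u + v).
Proof.
move=> [u1 u2 u3] [v1 v2 v3]; split.
- by move=> L hL; rewrite wg_cellE; apply: Pol_linear; [exact: u1|exact: v1].
- by move=> F hF; rewrite wg_faceE; apply: Pol_linear; [exact: u2|exact: v2].
- move=> F hF FO x Fx.
  by rewrite wg_faceE (u3 F hF FO x Fx) (v3 F hF FO x Fx) mulr0 addr0.
Qed.

Lemma Vh_cell v : Vh Omega r s v -> polynomial_function (v.1 K).
Proof. by move=> [/(_ _ hK)/Pol_polynomial]. Qed.

Lemma Vh_face v F : Vh Omega r s v -> F \in faces_of K -> polynomial_function (v.2 F).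
Proof.
move=> [_ v2 _] FK; apply: Pol_polynomial (v2 F _).
by apply/bigcupP; exists K.
Qed.

Lemma weak_divergence_sum v n (c : 'I_n -> R) (E : 'I_n -> 'rV[R]_d -> 'rV[R]_d) :
  Vh Omega r s v -> (forall k i, polynomial_function (fun x => E k x 0 i)) ->
  weak_divergence v (fun x => \sum_k c k *: E k x) =
  \sum_k c k * weak_divergence v (E k).
Proof.
move=> hv pE; rewrite /weak_divergence.
rewrite (_ : (fun x => v.1 K x * _) =
    fun x => \sum_k c k * (v.1 K x * divergence (E k) x)); last first.
  apply/funext => x; rewrite divergence_sum// mulr_sumr.
  by apply: eq_bigr => k _; rewrite mulrCA.
rewrite (cell_int_sum hM hK); last first.
  move=> k; apply: (polynomial_cell hM hK); apply: polynomialM; first exact: Vh_cell.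
  exact: polynomial_divergence.
under [X in _ + X]eq_bigr => F FK.
  rewrite (_ : (fun x => _) = fun x => \sum_k c k *
      (v.2 F x * dot (E k x) (outward_normal K F))); last first.
    apply/funext => x; rewrite /dot mulmx_suml summxE mulr_sumr.
    by apply: eq_bigr => k _; rewrite -scalemxAl mxE mulrCA.
  rewrite face_int_sum; last first.
    by move=> k; apply: polynomialM; [exact: Vh_face|exact: polynomial_dot_cst].
  over.
rewrite exchange_big -sumrN -big_split; apply: eq_bigr => k _.
by rewrite /= -mulr_sumr mulrDr mulrN.
Qed.

Lemma weak_divergence_linear (a : R) u v q : Vh Omega r s u -> Vh Omega r s v ->
  (forall i, polynomial_function (fun x => q x 0 i)) ->
  weak_divergence (a *: u + v) q = a * weak_divergence u q + weak_divergence v q.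
Proof.
move=> hu hv pq; rewrite /weak_divergence.
rewrite wg_cellE (_ : (fun x => _) = fun x => a * (u.1 K x * divergence q x) +
    v.1 K x * divergence q x); last by apply/funext => x; rewrite mulrA -mulrDl.
have pd := polynomial_divergence pq.
rewrite (cell_int_linear hM hK); last 2 first.
- by apply: (polynomial_cell hM hK); apply: polynomialM => //; exact: Vh_cell hu.
- by apply: (polynomial_cell hM hK); apply: polynomialM => //; exact: Vh_cell hv.
under eq_bigr => F FK.
  rewrite wg_faceE (_ : (fun x => _) = fun x => a * (u.2 F x * dot (q x) (outward_normal K F)) +
      v.2 F x * dot (q x) (outward_normal K F)); last first.
    by apply/funext => x; rewrite mulrA -mulrDl.
  rewrite face_int_linear; last 2 first.
  - by apply: polynomialM; [exact: Vh_face FK|exact: polynomial_dot_cst].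
  - by apply: polynomialM; [exact: Vh_face FK|exact: polynomial_dot_cst].
  over.
by rewrite big_split/= -mulr_sumr opprD mulrDr mulrN addrACA.
Qed.

Definition is_weak_grad v g : Prop := Gr r s g /\ forall q, Gr r s q ->
  cell_int K (fun x => dot (g x) (q x)) = weak_divergence v q.

(* The Gram matrix of a spanning family of G_r(K) may be singular, but a vector
   of its kernel is a linear relation of that family, because the L^2 norm of a
   polynomial on K vanishes only at 0; hence the linear system is solvable. *)
Lemma is_weak_grad_exists v : Vh Omega r s v -> exists g, is_weak_grad v g.
Proof.
move=> hv; have [n [E [pE GE]]] := Gr_span (R := R) (d := d) r s.
pose comb (c : 'I_n -> R) x := \sum_k c k *: E k x.
pose phi (i j : 'I_n) := cell_int K (fun x => dot (E i x) (E j x)).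
have pcomb c i : polynomial_function (fun x => comb c x 0 i).
  by apply: (@Gr_polynomial _ _ r s); apply/GE; exists c.
have combE c c' : cell_int K (fun x => dot (comb c x) (comb c' x)) =
    \sum_i \sum_j c' i * (c j * phi j i).
  rewrite (_ : (fun x => _) = fun x => \sum_i c' i * dot (comb c x) (E i x)).
    rewrite (cell_int_sum hM hK); last first.
      by move=> i; apply: (polynomial_cell hM hK); exact: polynomial_dot.
    apply: eq_bigr => i _; rewrite -mulr_sumr; congr (_ * _).
    rewrite -(cell_int_sum hM hK); last first.
      by move=> j; apply: (polynomial_cell hM hK); exact: polynomial_dot.
    congr (cell_int _ _); apply/funext => x; rewrite /dot mulmx_suml summxE.
    by apply: eq_bigr => j _; rewrite -scalemxAl mxE.
  apply/funext => x; rewrite /dot linear_sum/= mulmx_sumr summxE.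
  by apply: eq_bigr => i _; rewrite linearZ/= -scalemxAr mxE.
pose G : 'M[R]_n := \matrix_(i, j) phi i j.
pose L : 'rV[R]_n := \row_j weak_divergence v (E j).
have [y Gy0|c cG] := @row_orthogonal_kernel R n G L.
  have y0 : comb (fun k => y k 0) = fun=> 0.
    apply: (cell_int_dot_eq0 hM hK) => //; rewrite combE exchange_big big1// => j _.
    transitivity (y j 0 * (G *m y) j 0); last by rewrite Gy0 mxE mulr0.
    by rewrite mxE mulr_sumr; apply: eq_bigr => i _; rewrite mxE mulrCA [y i 0 * _]mulrC.
  apply/rowP => i; rewrite ord1 !mxE.
  transitivity (weak_divergence v (comb (fun k => y k 0))).
    rewrite weak_divergence_sum//; apply: eq_bigr => k _.
    by rewrite !mxE mulrC.
  rewrite y0 (_ : (fun=> 0) = fun x => \sum_k (fun=> 0) k *: E k x); last first.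
    by apply/funext => x; rewrite big1// => k _; rewrite scale0r.
  by rewrite weak_divergence_sum// big1// => k _; rewrite mul0r.
exists (comb (fun k => c 0 k)); split; first by apply/GE; exists (fun k => c 0 k).
move=> q /GE[c' ->]; rewrite combE weak_divergence_sum//.
apply: eq_bigr => i _; rewrite -mulr_sumr; congr (_ * _).
transitivity (L 0 i); last by rewrite mxE.
by rewrite -cG mxE; apply: eq_bigr => j _; rewrite mxE.
Qed.

(** Existence rules out the default value 0 of [xget]. *)
Lemma weak_gradP v : Vh Omega r s v -> is_weak_grad v (weak_grad r s v K).
Proof. by move=> /is_weak_grad_exists; exact: xgetPex. Qed.

(** The difference of two solutions lies in [Gr]; tested against itself it has zero L^2 norm on the
    cell. *)
Lemma is_weak_grad_unique v g g' : is_weak_grad v g -> is_weak_grad v g' -> g = g'.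
Proof.
move=> [Gg gv] [Gg' gv'].
pose h x : 'rV[R]_d := - 1 *: g' x + g x.
have Gh : Gr r s h by exact: Gr_linear.
have ph i : polynomial_function (fun x => h x 0 i) := Gr_polynomial i Gh.
have bdot p : Gr r s p -> bounded_measurable (open_simplex K) (fun x => dot (p x) (h x)).
  move=> Gp; apply: (polynomial_cell hM hK); apply: polynomial_dot => // i.
  exact: Gr_polynomial Gp.
suff h0 : h = fun=> 0.
  apply/funext => x; apply/eqP; rewrite -subr_eq0; apply/eqP.
  by have := congr1 (@^~ x) h0; rewrite /h scaleN1r addrC.
apply: (cell_int_dot_eq0 hM hK) => //.
rewrite (_ : (fun x => _) = fun x => - 1 * dot (g' x) (h x) + dot (g x) (h x)).
  rewrite (cell_int_linear hM hK); [|exact: bdot..].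
  by rewrite gv// gv'// mulN1r addNr.
by apply/funext => x; rewrite /dot mulmxDl -scalemxAl !mxE.
Qed.

(** Since [weak_grad] is a choice, linearity comes from uniqueness: the combination of the two
    gradients solves the problem posed for [a *: u + v]. *)
Lemma weak_grad_linear (a : R) u v : Vh Omega r s u -> Vh Omega r s v ->
  weak_grad r s (a *: u + v) K =
  fun x => a *: weak_grad r s u K x + weak_grad r s v K x.
Proof.
move=> hu hv; apply: (@is_weak_grad_unique (a *: u + v)).
  exact/weak_gradP/Vh_linear.
have [Gu gu] := weak_gradP hu; have [Gv gv] := weak_gradP hv.
split; first exact: Gr_linear.
move=> q Gq; rewrite weak_divergence_linear//; last by move=> i; exact: Gr_polynomial Gq.
rewrite -gu// -gv// -(cell_int_linear hM hK); last 2 first.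
- apply: (polynomial_cell hM hK); apply: polynomial_dot => i.
    exact: Gr_polynomial Gu.
  exact: Gr_polynomial Gq.
- apply: (polynomial_cell hM hK); apply: polynomial_dot => i.
    exact: Gr_polynomial Gv.
  exact: Gr_polynomial Gq.
congr (cell_int _ _); apply/funext => x.
by rewrite /dot mulmxDl -scalemxAl !mxE.
Qed.

End weak_gradient.

(** Serves to collapse an expansion tested against one vector of an orthogonal family. *)
Lemma suml_pick (R : pzSemiRingType) m n (c g : nat -> R) i : (m <= i < n)%N ->
  (forall j, (m <= j < n)%N -> j != i -> g j = 0) ->
  \sum_(m <= j < n) c j * g j = c i * g i.
Proof.
move=> mi g0; rewrite (bigD1_seq i) ?mem_index_iota ?iota_uniq//=.
rewrite [X in _ + X]big1_seq ?addr0// => j /andP[ji].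
by rewrite mem_index_iota => /g0 ->//; rewrite mulr0.
Qed.

(** * Symmetric positive semidefinite forms on a subspace *)

Section semidefinite_forms.
Context {R : realType} {E : lmodType R} (V : set E) (f : E -> E -> R).
Hypothesis V_linear : forall a u v, V u -> V v -> V (a *: u + v).
Hypothesis f_linear : forall a u v w, V u -> V v -> V w ->
  f (a *: u + v) w = a * f u w + f v w.
Hypothesis fC : forall u v, f u v = f v u.
Hypothesis f_ge0 : forall v, 0 <= f v v.

(** Closure under combinations alone leaves [V] possibly empty, hence the witness [u], also passed
    to [subspace_sum]. *)
Let V0 u : V u -> V 0.
Proof. by move=> Vu; have := V_linear (-1) Vu Vu; rewrite scaleN1r addNr. Qed.

Lemma subspaceD u v : V u -> V v -> V (u + v).
Proof. by move=> Vu Vv; rewrite -[u]scale1r; exact: V_linear. Qed.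

Lemma subspaceB u v : V u -> V v -> V (u - v).
Proof. by move=> Vu Vv; rewrite addrC -scaleN1r; exact: V_linear. Qed.

Lemma subspace_sum u m n (c : nat -> R) (e : nat -> E) : V u ->
  (forall j, (m <= j < n)%N -> V (e j)) -> V (\sum_(m <= j < n) c j *: e j).
Proof.
move=> Vu Ve; rewrite big_nat; apply: (big_ind V); first exact: V0 Vu.
  exact: subspaceD.
by move=> j /Ve Vj; rewrite -[_ *: _]addr0; apply: V_linear => //; exact: V0 Vu.
Qed.

Lemma formDl u v w : V u -> V v -> V w -> f (u + v) w = f u w + f v w.
Proof. by move=> Vu Vv Vw; rewrite -[u in LHS]scale1r f_linear// mul1r. Qed.

Lemma formBl u v w : V u -> V v -> V w -> f (u - v) w = f u w - f v w.
Proof. by move=> Vu Vv Vw; rewrite addrC -scaleN1r f_linear// mulN1r addrC. Qed.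

Lemma form0l w : V w -> f 0 w = 0.
Proof. by move=> Vw; rewrite -(subrr w) formBl// subrr. Qed.

Lemma formNN v : V (- v) -> V v -> f (- v) (- v) = f v v.
Proof.
move=> VN Vv; have V0v : V 0 by rewrite -(addNr v); exact: subspaceD.
have V0Nv : V (0 - v) by rewrite sub0r.
by rewrite -[- v]sub0r formBl// form0l// [f v _]fC formBl// form0l// !sub0r opprK.
Qed.

Lemma form_suml m n (c : nat -> R) (e : nat -> E) w : V w ->
  (forall j, (m <= j < n)%N -> V (e j)) ->
  f (\sum_(m <= j < n) c j *: e j) w = \sum_(m <= j < n) c j * f (e j) w.
Proof.
move=> Vw; elim: n => [|n IH] Ve; first by rewrite !big_geq// form0l.
have [mn|nm] := leqP m n; last by rewrite !big_geq// form0l.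
have Ve' j : (m <= j < n)%N -> V (e j).
  by move=> /andP[mj jn]; apply: Ve; rewrite mj ltnW.
rewrite !big_nat_recr//= addrC f_linear//; last exact: (subspace_sum _ Vw).
  by rewrite IH// addrC.
by apply: Ve; rewrite mn leqnn.
Qed.

Lemma cauchy_schwarz u v : V u -> V v -> f u v ^+ 2 <= f u u * f v v.
Proof.
move=> Vu Vv.
have quad t : 0 <= t ^+ 2 * f u u + 2 * t * f u v + f v v.
  have := f_ge0 (t *: u + v); have Vtuv := V_linear t Vu Vv.
  rewrite f_linear// fC f_linear// [f v (t *: u + v)]fC f_linear// [f v u]fC.
  by congr (_ <= _); ring.
have [uu0|uu0] := eqVneq (f u u) 0.
  rewrite uu0 mul0r; have [->|uv0] := eqVneq (f u v) 0; first by rewrite expr0n.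
  (* The form may be degenerate. With [f u u = 0] the quadratic is affine in [t], and this [t] gives
     it the value -1. *)
  have := quad (- (f v v + 1) / (2 * f u v)).
  rewrite uu0 mulr0 add0r (_ : 2 * _ * _ = - (f v v + 1)); last by field; rewrite uv0.
  by rewrite opprD addrAC addNr add0r oppr_ge0 ler10.
have upos : 0 < f u u by rewrite lt_def uu0 f_ge0.
(* The minimiser of the quadratic. *)
have := quad (- f u v / f u u).
rewrite (_ : _ + _ = (f u u * f v v - f u v ^+ 2) / f u u); last by field; rewrite uu0.
by rewrite pmulr_lge0 ?invr_gt0// subr_ge0.
Qed.

Lemma seminorm_triangle u v : V u -> V v ->
  Num.sqrt (f (u + v) (u + v)) <= Num.sqrt (f u u) + Num.sqrt (f v v).
Proof.
move=> Vu Vv; have Vuv := subspaceD Vu Vv.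
rewrite -[leRHS]ger0_norm ?addr_ge0 ?sqrtr_ge0// -sqrtr_sqr ler_sqrt ?sqr_ge0//.
rewrite sqrrD !sqr_sqrtr// formDl// [f u _]fC [f v _]fC !formDl// [f v u]fC.
have : f u v <= Num.sqrt (f u u) * Num.sqrt (f v v).
  rewrite -sqrtrM// (le_trans (ler_norm _))// -sqrtr_sqr ler_sqrt ?mulr_ge0//.
  exact: cauchy_schwarz.
rewrite mulr2n; lra.
Qed.

(** Pythagoras: [f w w] exceeds [f v v] by [f (w - v) (w - v)], which is non-negative. *)
Lemma orthogonal_projection_le w v : V w -> V v -> f (w - v) v = 0 -> f v v <= f w w.
Proof.
move=> Vw Vv; rewrite formBl// => /eqP; rewrite subr_eq0 => /eqP wv.
have := f_ge0 (w - v); have Vwv := subspaceB Vw Vv.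
by rewrite formBl// [f w _]fC [f v _]fC !formBl// [f v w]fC wv subrr subr0 subr_ge0.
Qed.

End semidefinite_forms.

(** * The abstract spectral projection estimate *)

Section spectral_projection.
Context {R : realType} {E : lmodType R} (V : set E) (a b : E -> E -> R).
Hypothesis V_linear : forall c u v, V u -> V v -> V (c *: u + v).
Hypothesis a_linear : forall c u v w, V u -> V v -> V w ->
  a (c *: u + v) w = c * a u w + a v w.
Hypothesis b_linear : forall c u v w, V u -> V v -> V w ->
  b (c *: u + v) w = c * b u w + b v w.
Hypothesis aC : forall u v, a u v = a v u.
Hypothesis bC : forall u v, b u v = b v u.
Hypothesis a_ge0 : forall v, 0 <= a v v.
Hypothesis b_ge0 : forall v, 0 <= b v v.

Variables (N : nat) (lamh : nat -> R) (uh : nat -> E).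
Hypothesis V_uh : forall j, (0 < j < N.+1)%N -> V (uh j).
Hypothesis lamh_gt0 : forall j, (0 < j < N.+1)%N -> 0 < lamh j.
Hypothesis uh_eigen : forall j v, (0 < j < N.+1)%N -> V v ->
  a (uh j) v = lamh j * b (uh j) v.
Hypothesis lamh_le : forall i j, (0 < i)%N -> (i <= j < N.+1)%N -> lamh i <= lamh j.
Hypothesis uh_orthonormal : forall i j, (0 < i < N.+1)%N -> (0 < j < N.+1)%N ->
  a (uh i) (uh j) = (i == j)%:R.
Hypothesis uh_span : forall w, V w -> exists y : nat -> R, forall z, V z ->
  b w z = \sum_(1 <= j < N.+1) y j * b (uh j) z.

Variables (k : nat) (Fk : E -> E).
Hypothesis ltkN : (k < N)%N.
Hypothesis Fk_span : forall w, V w ->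
  exists c : nat -> R, Fk w = \sum_(1 <= j < k.+1) c j *: uh j.
Hypothesis Fk_orth : forall w i, V w -> (1 <= i <= k)%N -> a (Fk w) (uh i) = a w (uh i).

Local Notation nrma v := (Num.sqrt (a v v)).
Local Notation nrmb v := (Num.sqrt (b v v)).

Let k_range j : (0 < j < k.+1)%N -> (0 < j < N.+1)%N.
Proof. by move=> /andP[-> jk]/=; apply: (leq_trans jk); exact: ltnW. Qed.

Let tail_range j : (k < j < N.+1)%N -> (0 < j < N.+1)%N.
Proof. by move=> /andP[kj ->]; rewrite andbT; exact: leq_ltn_trans kj. Qed.

Let V_u1 : V (uh 1).
Proof. by apply: V_uh; rewrite /= ltnS (leq_trans _ ltkN). Qed.

Lemma uh_b i j : (0 < i < N.+1)%N -> (0 < j < N.+1)%N ->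
  b (uh i) (uh j) = (i == j)%:R / lamh i.
Proof.
move=> hi hj; have l0 := lamh_gt0 hi.
by rewrite -(uh_orthonormal hi hj) (uh_eigen hi (V_uh hj)) mulrAC divff ?mul1r ?gt_eqF.
Qed.

Lemma b_uh v j : V v -> (0 < j < N.+1)%N -> b v (uh j) = a v (uh j) / lamh j.
Proof.
move=> Vv hj; have l0 := lamh_gt0 hj.
by rewrite [a v _]aC uh_eigen// mulrAC divff ?mul1r ?gt_eqF// bC.
Qed.

(** [Fk] is given by its range and its orthogonality relations, not as a linear map. Orthonormality
    fixes the coefficients, and additivity follows from the formula. *)
Lemma FkE w : V w -> Fk w = \sum_(1 <= j < k.+1) a w (uh j) *: uh j.
Proof.
move=> Vw; have [c Fc] := Fk_span Vw; rewrite Fc.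
rewrite big_nat [RHS]big_nat; apply: eq_bigr => i hi; congr (_ *: _).
rewrite -Fk_orth// Fc (form_suml V_linear a_linear); last 2 first.
- exact/V_uh/k_range.
- by move=> j /k_range/V_uh.
rewrite (@suml_pick _ _ _ _ _ i)//; first by rewrite uh_orthonormal ?eqxx ?mulr1//; exact: k_range.
by move=> j hj ji; rewrite uh_orthonormal ?(negbTE ji)//; exact: k_range.
Qed.

Lemma V_Fk w : V w -> V (Fk w).
Proof.
move=> Vw; rewrite FkE//; apply: (subspace_sum V_linear _ Vw) => j /k_range.
exact: V_uh.
Qed.

Lemma Fk_contract_a w : V w -> a (Fk w) (Fk w) <= a w w.
Proof.
move=> Vw; have VF := V_Fk Vw.
apply: (orthogonal_projection_le V_linear a_linear) => //.
rewrite aC {1}FkE// (form_suml V_linear a_linear); last 2 first.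
- exact: subspaceB.
- by move=> j /k_range/V_uh.
rewrite big_nat big1// => j hj; have Vj := V_uh (k_range hj).
by rewrite [a (uh j) _]aC (formBl a_linear)// Fk_orth// subrr mulr0.
Qed.

(** By [b_uh], orthogonality to [uh j] in [a] implies orthogonality in [b], so the residual is
    orthogonal to the range of [Fk] for both forms. *)
Lemma Fk_contract_b w : V w -> b (Fk w) (Fk w) <= b w w.
Proof.
move=> Vw; have VF := V_Fk Vw.
apply: (orthogonal_projection_le V_linear b_linear) => //.
rewrite bC {1}FkE// (form_suml V_linear b_linear); last 2 first.
- exact: subspaceB.
- by move=> j /k_range/V_uh.
rewrite big_nat big1// => j hj; have Vj := V_uh (k_range hj).
rewrite bC (formBl b_linear)// !b_uh//; last 2 first.
- exact: k_range.
- exact: k_range.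
by rewrite Fk_orth// subrr mulr0.
Qed.

Lemma FkB u v : V u -> V v -> Fk (u - v) = Fk u - Fk v.
Proof.
move=> Vu Vv; rewrite !FkE//; last exact: subspaceB.
rewrite -sumrB big_nat [RHS]big_nat; apply: eq_bigr => j /k_range/V_uh Vj.
by rewrite (formBl a_linear)// scalerBl.
Qed.

(** Stated for any form diagonal on the eigenvectors: [g] is 1 for [a] and the inverse eigenvalue
    for [b]. *)
Lemma tail_form (f : E -> E -> R) (g c : nat -> R) :
  (forall c u v w, V u -> V v -> V w -> f (c *: u + v) w = c * f u w + f v w) ->
  (forall u v, f u v = f v u) ->
  (forall i j, (0 < i < N.+1)%N -> (0 < j < N.+1)%N ->
     f (uh i) (uh j) = (i == j)%:R * g i) ->
  let y := \sum_(k.+1 <= j < N.+1) c j *: uh j in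
  f y y = \sum_(k.+1 <= j < N.+1) c j ^+ 2 * g j.
Proof.
move=> f_linear fC fuh y.
have Vy : V y by apply: (subspace_sum V_linear _ V_u1) => j /tail_range/V_uh.
rewrite {1}/y (form_suml V_linear f_linear)//; last by move=> j /tail_range/V_uh.
rewrite big_nat [RHS]big_nat; apply: eq_bigr => i hi.
have Vi := V_uh (tail_range hi).
rewrite fC /y (form_suml V_linear f_linear)//; last by move=> j /tail_range/V_uh.
rewrite (@suml_pick _ _ _ _ _ i)//; last first.
  by move=> j hj ji; rewrite fuh ?(negbTE ji) ?mul0r//; exact: tail_range.
by rewrite fuh ?eqxx ?mul1r ?mulrA ?expr2//; exact: tail_range.
Qed.

(** As [b (uh j) (uh j)] is the inverse of [lamh j], the weight [lamh j] normalises the eigenvectors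
    in [b], and [y] is the [b]-orthogonal projection of [g] onto those beyond [k]. *)
Lemma bessel g : V g ->
  \sum_(k.+1 <= j < N.+1) lamh j * b g (uh j) ^+ 2 <= b g g.
Proof.
move=> Vg; pose y := \sum_(k.+1 <= j < N.+1) (lamh j * b g (uh j)) *: uh j.
have Vy : V y by apply: (subspace_sum V_linear _ V_u1) => j /tail_range/V_uh.
have uhbE i j : (0 < i < N.+1)%N -> (0 < j < N.+1)%N ->
    b (uh i) (uh j) = (i == j)%:R * (lamh i)^-1 by exact: uh_b.
have yy : b y y = \sum_(k.+1 <= j < N.+1) lamh j * b g (uh j) ^+ 2.
  rewrite (tail_form _ b_linear bC uhbE) big_nat [RHS]big_nat.
  apply: eq_bigr => j /tail_range/lamh_gt0 l0.
  by rewrite exprMn; field; rewrite gt_eqF.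
rewrite -yy; apply: (orthogonal_projection_le V_linear b_linear) => //.
rewrite bC {1}/y (form_suml V_linear b_linear); last 2 first.
- exact: subspaceB.
- by move=> j /tail_range/V_uh.
rewrite big_nat big1// => i hi; have Vi := V_uh (tail_range hi).
rewrite [b (uh i) _]bC (formBl b_linear)// /y (form_suml V_linear b_linear)//; last first.
  by move=> j /tail_range/V_uh.
rewrite (@suml_pick _ _ _ _ _ i)//; last first.
  by move=> j hj ji; rewrite uh_b ?(negbTE ji) ?mul0r//; exact: tail_range.
have l0 := lamh_gt0 (tail_range hi).
rewrite uh_b ?eqxx; [|exact: tail_range..].
by rewrite mul1r [lamh i * _]mulrC mulfK ?gt_eqF// subrr mulr0.
Qed.

Variables (lam delta : R) (q p : E).
Hypotheses (lam_gt0 : 0 < lam) (delta_gt0 : 0 < delta).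
Hypothesis gap : forall j, (k < j < N.+1)%N -> delta <= `|(lamh j)^-1 - lam^-1|.
Hypotheses (Vq : V q) (Vp : V p).
Hypothesis p_galerkin : forall v, V v -> a p v = lam * b q v.

Local Notation mu := (lamh k.+1)^-1.
Let tail := \sum_(k.+1 <= j < N.+1) a p (uh j) *: uh j.
(* p may have a component with vanishing v_0, but both forms vanish on it. *)
Let null := p - \sum_(1 <= j < N.+1) a p (uh j) *: uh j.

Let V_tail : V tail.
Proof. by apply: (subspace_sum V_linear _ Vp) => j /tail_range/V_uh. Qed.

Let V_null : V null.
Proof. by apply: (subspaceB V_linear) => //; exact: (subspace_sum V_linear _ Vp). Qed.

Lemma null_uh j : (0 < j < N.+1)%N -> a null (uh j) = 0.
Proof.
move=> hj; have Vj := V_uh hj.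
have Vs := subspace_sum V_linear (fun j => a p (uh j)) Vp V_uh.
rewrite (formBl a_linear)// (form_suml V_linear a_linear)//.
rewrite (@suml_pick _ _ _ _ _ j)//; last first.
  by move=> i hi ij; rewrite uh_orthonormal// (negbTE ij).
by rewrite uh_orthonormal// eqxx mulr1 subrr.
Qed.

(** By [uh_span], [b null] is a combination of the [b (uh j)], and each of these vanishes at [null],
    which is orthogonal to every [uh j]. *)
Lemma null_b : b null null = 0.
Proof.
have [y ->//] := uh_span V_null; rewrite big_nat big1// => j hj.
by rewrite bC b_uh// null_uh// mul0r mulr0.
Qed.

(** Orthogonality reduces [a null null] to [a p null], that is [lam * b q null], which vanishes by
    Cauchy-Schwarz because [b null null = 0]. *)
Lemma null_a : a null null = 0.
Proof.
have Vs := subspace_sum V_linear (fun j => a p (uh j)) Vp V_uh.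
rewrite {1}/null (formBl a_linear)// (form_suml V_linear a_linear)//.
rewrite [X in _ - X]big_nat [X in _ - X]big1 => [|j hj]; last first.
  by rewrite [a (uh j) _]aC null_uh// mulr0.
rewrite subr0 p_galerkin//.
have := cauchy_schwarz V_linear b_linear bC b_ge0 Vq V_null.
rewrite null_b mulr0 => b0.
have /eqP : b q null ^+ 2 = 0 by apply/eqP; rewrite eq_le b0 sqr_ge0.
by rewrite sqrf_eq0 => /eqP ->; rewrite mulr0.
Qed.

Lemma p_decomposition : p - Fk p = null + tail.
Proof.
rewrite FkE// /null (@big_cat_nat _ _ _ k.+1 1%N N.+1)//=; last exact: ltnW.
by rewrite /tail opprD addrA subrK.
Qed.

Lemma tail_coefficient j : (k < j < N.+1)%N ->
  delta ^+ 2 * a p (uh j) ^+ 2 <= b (q - p) (uh j) ^+ 2.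
Proof.
move=> hj; have hj' := tail_range hj; have Vj := V_uh hj'.
have l0 := lamh_gt0 hj'.
(* The term in [q] comes from the Galerkin equation of [p], the term in [p] from the eigenvalue
   equation of [uh j]. *)
have -> : b (q - p) (uh j) = (lam^-1 - (lamh j)^-1) * a p (uh j).
  have bq : b q (uh j) = lam^-1 * a p (uh j) by rewrite p_galerkin// mulKf ?gt_eqF.
  by rewrite (formBl b_linear)// bq b_uh// mulrBl [_ / lamh j]mulrC.
rewrite exprMn ler_wpM2r ?sqr_ge0// -[leRHS]real_normK ?num_real//.
by apply: lerXn2r; rewrite ?nnegrE ?normr_ge0 ?(ltW delta_gt0)// distrC; exact: gap.
Qed.

Lemma tail_a : delta ^+ 2 * a tail tail <= mu * b (q - p) (q - p).
Proof.
have uhE i j : (0 < i < N.+1)%N -> (0 < j < N.+1)%N ->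
    a (uh i) (uh j) = (i == j)%:R * 1 by move=> *; rewrite mulr1 uh_orthonormal.
have hk : (0 < k.+1 < N.+1)%N by [].
have mu0 : 0 <= mu by rewrite invr_ge0 ltW// lamh_gt0.
rewrite (tail_form _ a_linear aC uhE) mulr_sumr.
(* Since [lamh] is non-decreasing, [mu * lamh j] is at least 1 beyond [k]; inserting this factor
   produces the Bessel sum. *)
apply: (@le_trans _ _ (mu * \sum_(k.+1 <= j < N.+1) lamh j * b (q - p) (uh j) ^+ 2)).
  rewrite mulr_sumr big_nat [leRHS]big_nat; apply: ler_sum => j hj; rewrite mulr1.
  apply: (le_trans (tail_coefficient hj)); rewrite mulrA ler_peMl ?sqr_ge0//.
  rewrite mulrC ler_pdivlMr ?lamh_gt0// mul1r.
  by apply: lamh_le.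
by rewrite ler_wpM2l// bessel//; exact: subspaceB.
Qed.

(** On the tail eigenvectors the ratio of [b] to [a] is the inverse of [lamh j], at most [mu] by
    monotonicity. *)
Lemma tail_b : b tail tail <= mu * a tail tail.
Proof.
have uhE i j : (0 < i < N.+1)%N -> (0 < j < N.+1)%N ->
    a (uh i) (uh j) = (i == j)%:R * 1 by move=> *; rewrite mulr1 uh_orthonormal.
have uhbE i j : (0 < i < N.+1)%N -> (0 < j < N.+1)%N ->
    b (uh i) (uh j) = (i == j)%:R * (lamh i)^-1 by exact: uh_b.
have hk : (0 < k.+1 < N.+1)%N by [].
rewrite (tail_form _ a_linear aC uhE) (tail_form _ b_linear bC uhbE) mulr_sumr.
rewrite big_nat [leRHS]big_nat; apply: ler_sum => j hj; rewrite mulr1 mulrC.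
rewrite ler_wpM2r ?sqr_ge0// lef_pV2 ?posrE ?lamh_gt0 ?lamh_le//.
exact: tail_range.
Qed.

Lemma spectral_projection_error_p :
  nrma (p - Fk p) <= Num.sqrt mu / delta * nrmb (q - p) /\
  nrmb (p - Fk p) <= mu / delta * nrmb (q - p).
Proof.
have mu0 : 0 <= mu by rewrite invr_ge0 ltW// lamh_gt0.
have ta : nrma tail <= Num.sqrt mu / delta * nrmb (q - p).
  rewrite mulrAC ler_pdivlMr// -{1}[delta]ger0_norm ?(ltW delta_gt0)// -sqrtr_sqr.
  rewrite -!sqrtrM// ler_sqrt ?mulr_ge0//.
  by rewrite mulrC; exact: tail_a.
have tb : nrmb tail <= Num.sqrt mu * nrma tail.
  by rewrite -sqrtrM// ler_sqrt ?mulr_ge0//; exact: tail_b.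
rewrite p_decomposition; split.
  apply: (le_trans (seminorm_triangle V_linear a_linear aC a_ge0 V_null V_tail)).
  by rewrite null_a sqrtr0 add0r.
apply: (le_trans (seminorm_triangle V_linear b_linear bC b_ge0 V_null V_tail)).
rewrite null_b sqrtr0 add0r; apply: (le_trans tb).
(* One factor [Num.sqrt mu] from [tb] and one from [ta] combine into [mu]. *)
apply: (le_trans (ler_wpM2l (sqrtr_ge0 _) ta)).
by rewrite !mulrA -expr2 sqr_sqrtr.
Qed.

Lemma spectral_projection_error :
  nrma (q - Fk q) <= 2 * nrma (q - p) + Num.sqrt mu / delta * nrmb (q - p) /\
  nrmb (q - Fk q) <= (2 + mu / delta) * nrmb (q - p).
Proof.
have Vqp : V (q - p) by exact: subspaceB.
have VFqp := V_Fk Vqp.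
have VF : V (p - Fk p) by apply: (subspaceB V_linear) => //; exact: V_Fk.
have VD : V (q - p - Fk (q - p)) by exact: subspaceB.
have split_q : q - Fk q = (q - p - Fk (q - p)) + (p - Fk p).
  by rewrite FkB// opprB addrACA subrK [_ - Fk q - _]addrAC subrr add0r.
have [pa pb] := spectral_projection_error_p.
have VN : V (- Fk (q - p)).
  by rewrite -scaleN1r -[_ *: _]addr0 -(subrr q); apply: V_linear => //; exact: subspaceB.
rewrite split_q; split.
  apply: (le_trans (seminorm_triangle V_linear a_linear aC a_ge0 VD VF)).
  apply: lerD pa.
  (* Source of the constant 2: the triangle inequality on [q - p] minus its projection, then the
     contraction property of [Fk]. *)
  apply: (le_trans (seminorm_triangle V_linear a_linear aC a_ge0 Vqp VN)).
  rewrite mulr2n mulrDl mul1r lerD2l (formNN V_linear a_linear aC VN VFqp).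
  by rewrite ler_sqrt//; exact: Fk_contract_a.
apply: (le_trans (seminorm_triangle V_linear b_linear bC b_ge0 VD VF)).
rewrite [leRHS]mulrDl; apply: lerD pb.
apply: (le_trans (seminorm_triangle V_linear b_linear bC b_ge0 Vqp VN)).
rewrite mulr2n mulrDl mul1r lerD2l (formNN V_linear b_linear bC VN VFqp).
by rewrite ler_sqrt//; exact: Fk_contract_b.
Qed.

End spectral_projection.

(** * Pointwise properties of the coefficient matrix *)

Section coefficient_matrix.
Context {R : realType} {d : nat} (Omega : set 'rV[R]_d).
Context (A : 'rV[R]_d -> 'M[R]_d) (cA CA : R).
Hypotheses (cA_gt0 : 0 < cA) (CA_gt0 : 0 < CA) (hA : coefficient Omega A cA CA).

Let quad_ge0 x (xi : 'cV[R]_d) : Omega x -> 0 <= (xi^T *m A x *m xi) 0 0.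
Proof.
case: hA => _ _ _ ellA Ox; have /andP[+ _] := ellA x xi Ox; apply: le_trans.
apply: mulr_ge0; first exact: ltW.
by rewrite mxE; apply: sumr_ge0 => i _; rewrite mxE -expr2 sqr_ge0.
Qed.

Lemma coefficient_ge0 x (g : 'rV[R]_d) : Omega x -> 0 <= dot (g *m (A x)^T) g.
Proof.
move=> Ox; have := quad_ge0 g^T Ox.
by case: hA => _ _ symA _; rewrite trmxK /dot symA.
Qed.

Lemma coefficientC x (g g' : 'rV[R]_d) : Omega x ->
  dot (g *m (A x)^T) g' = dot (g' *m (A x)^T) g.
Proof.
case: hA => _ _ symA ellA Ox; rewrite /dot symA//.
transitivity ((g *m A x *m g'^T)^T 0 0); first by rewrite [RHS]mxE.
by rewrite !trmx_mul trmxK symA// mulmxA.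
Qed.

(* Polarization: 4 A_ij is the difference of the values of the quadratic form
   at e_i + e_j and e_i - e_j, which lie in [0, 4 CA]. *)
Lemma coefficient_entry_le x i j : Omega x -> `|A x i j| <= CA.
Proof.
case: hA => _ _ symA ellA Ox.
pose B (M : 'M[R]_d) (xi eta : 'cV[R]_d) := (xi^T *m M *m eta) 0 0.
have BE M k l : B M (delta_mx k 0) (delta_mx l 0) = M k l.
  by rewrite /B trmx_delta -rowE -colE !mxE.
have Bl M a xi xi' eta : B M (xi + a *: xi') eta = B M xi eta + a * B M xi' eta.
  by rewrite /B linearD linearZ/= !mulmxDl -!scalemxAl mxE [X in _ + X]mxE.
have Br M a xi xi' eta : B M eta (xi + a *: xi') = B M eta xi + a * B M eta xi'.
  by rewrite /B mulmxDr -scalemxAr mxE [X in _ + X]mxE.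
have bounds sg : sg ^+ 2 = 1 ->
    0 <= A x i i + sg * A x i j + sg * A x j i + A x j j <= CA * (2 + 2 * sg * (i == j)%:R).
  move=> sg2; pose xi : 'cV[R]_d := delta_mx i 0 + sg *: delta_mx j 0.
  have BxiE M : B M xi xi = M i i + sg * M i j + sg * M j i + M j j.
    by rewrite /xi Bl !Br !BE mulrDr mulrA -expr2 sg2 mul1r !addrA.
  have /andP[_ ub] := ellA x xi Ox.
  have := quad_ge0 xi Ox; rewrite -/(B (A x) xi xi) BxiE => -> /=.
  move: ub; rewrite -/(B (A x) xi xi) BxiE => /le_trans; apply.
  rewrite (_ : (xi^T *m xi) 0 0 = B 1%:M xi xi); last by rewrite /B mulmx1.
  apply: ler_wpM2l; first exact: ltW.
  rewrite BxiE !mxE !eqxx [j == i]eq_sym.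
  by rewrite (_ : 2 + _ = 1%:R + sg * (i == j)%:R + sg * (i == j)%:R + 1%:R)//; ring.
have := bounds 1; have := bounds (-1); rewrite sqrrN expr1n => /(_ erefl) + /(_ erefl).
have Aji : A x j i = A x i j by rewrite -{1}(symA x Ox) mxE.
by rewrite Aji ler_norml; case: (i == j) => /= /andP[? ?] /andP[? ?]; apply/andP; split; nra.
Qed.

(** Needed to restrict the measurability of [A] from [Omega] to a cell. *)
Lemma measurable_convex_polytopal_domain :
  convex_polytopal_domain Omega -> measurable Omega.
Proof.
move=> [_ _ [m [nu [c ->]]]].
rewrite (_ : [set _ | _] = \bigcap_i [set x : 'rV[R]_d | dot (nu i) x < c i]); last first.
  by apply/seteqP; split => x Ox i => [_|]; exact: Ox.
apply: fin_bigcap_measurable => // i _; rewrite -[X in measurable X]setTI.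
have pd : polynomial_function (dot (nu i)).
  rewrite (_ : dot (nu i) = fun x => \sum_l nu i 0 l * x 0 l).
    apply: polynomial_sum => l.
    by apply: polynomialM; [exact: polynomial_cst|exact: polynomial_coord].
  by apply/funext => x; rewrite dotE.
apply: (polynomial_measurable pd measurableT (Y := [set y | y < c i])).
by apply: open_measurable; exact: open_lt.
Qed.

End coefficient_matrix.

(** * The forms [ah] and [bh] and the span of the discrete eigenfunctions *)

Section discrete_forms.
Context {R : realType} {d : nat} (Omega : set 'rV[R]_d) (M : mesh R d) (r s : nat).
Context (A : 'rV[R]_d -> 'M[R]_d) (cA CA : R).
Hypotheses (cA_gt0 : 0 < cA) (CA_gt0 : 0 < CA) (hA : coefficient Omega A cA CA).
Hypothesis hOmega : convex_polytopal_domain Omega.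
Hypothesis hM : is_mesh M Omega.
Implicit Types u v w : wg M.

Local Notation Vh := (Vh Omega r s).

Let cell_subset K : K \in cells M -> open_simplex K `<=` Omega.
Proof. by move=> hK; case: hM => /(_ _ hK)[]. Qed.

Lemma ahC u v : ah r s A u v = ah r s A v u.
Proof.
apply: eq_bigr => K hK; apply: eq_Rintegral => x /set_mem/(cell_subset hK).
exact: coefficientC hA _ _ _.
Qed.

Lemma ah_ge0 v : 0 <= ah r s A v v.
Proof.
apply: sumr_ge0 => K hK; apply: Rintegral_ge0 => x /(cell_subset hK).
exact: coefficient_ge0 hA _ _.
Qed.

(** [bounded_measurable] asks for a bound at every point of the cell; ellipticity, which holds
    pointwise on [Omega], supplies it. *)
Lemma bounded_measurable_coefficient K i j : K \in cells M ->
  bounded_measurable (open_simplex K) (fun x => A x i j).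
Proof.
move=> hK; split; last first.
  by exists CA => x /(cell_subset hK); exact: coefficient_entry_le hA _ _ _.
apply: measurable_funS (cell_subset hK) _; last by case: hA.
exact: measurable_convex_polytopal_domain.
Qed.

Lemma ah_linear (a : R) u v w : Vh u -> Vh v -> Vh w ->
  ah r s A (a *: u + v) w = a * ah r s A u w + ah r s A v w.
Proof.
move=> hu hv hw; rewrite mulr_sumr -big_split; apply: eq_bigr => K hK /=.
have Gw v' : Vh v' -> Gr r s (weak_grad r s v' K).
  by move=> hv'; have [] := weak_gradP hM hK hv'.
have bnd v' : Vh v' -> bounded_measurable (open_simplex K)
    (fun x => dot (weak_grad r s v' K x *m (A x)^T) (weak_grad r s w K x)).
  move=> hv'; under eq_fun do rewrite dotE.
  apply: bounded_measurable_sum => i _; apply: bounded_measurableM; last first.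
    by apply: (polynomial_cell hM hK); apply: Gr_polynomial; exact: Gw.
  under eq_fun do rewrite mxE.
  apply: bounded_measurable_sum => j _; apply: bounded_measurableM.
    by apply: (polynomial_cell hM hK); apply: Gr_polynomial; exact: Gw.
  under eq_fun do rewrite mxE; exact: bounded_measurable_coefficient.
rewrite -(cell_int_linear hM hK); [|exact: bnd..].
congr (cell_int _ _); apply/funext => x.
by rewrite (weak_grad_linear hM hK)// /dot mulmxDl -scalemxAl mulmxDl -scalemxAl !mxE.
Qed.

Lemma bhC u v : bh u v = bh v u.
Proof. by apply: eq_bigr => K _; apply: eq_Rintegral => x _; exact: mulrC. Qed.

Lemma bh_ge0 v : 0 <= bh v v.
Proof.
by apply: sumr_ge0 => K _; apply: Rintegral_ge0 => x _; rewrite -expr2 sqr_ge0.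
Qed.

Let bh_bounded K u w : K \in cells M -> Vh u -> Vh w ->
  bounded_measurable (open_simplex K) (fun x => u.1 K x * w.1 K x).
Proof.
move=> hK hu hw; apply: (polynomial_cell hM hK).
by apply: polynomialM; [exact: Vh_cell hu|exact: Vh_cell hw].
Qed.

Lemma bh_linear (a : R) u v w : Vh u -> Vh v -> Vh w ->
  bh (a *: u + v) w = a * bh u w + bh v w.
Proof.
move=> hu hv hw; rewrite mulr_sumr -big_split; apply: eq_bigr => K hK /=.
rewrite -(cell_int_linear hM hK); [|exact: bh_bounded..].
by congr (cell_int _ _); apply/funext => x; rewrite mulrA -mulrDl.
Qed.

(** The element of [interior_space] attached to [v]. It keeps only the values on the open cells,
    which are exactly what [bh] integrates. *)
Definition interior v : {set node M} -> 'rV[R]_d -> R :=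
  fun K => if K \in cells M then v.1 K \_ (open_simplex K) else 0.

Lemma bh_interior n (y : 'I_n -> R) (U : 'I_n -> wg M) w z :
  (forall k, Vh (U k)) -> Vh z -> interior w = \sum_k y k *: interior (U k) ->
  bh w z = \sum_k y k * bh (U k) z.
Proof.
move=> hU hz wU; rewrite /bh; under [RHS]eq_bigr do rewrite mulr_sumr.
rewrite exchange_big; apply: eq_bigr => K hK /=.
rewrite -(cell_int_sum hM hK); last by move=> k; exact: bh_bounded.
apply: eq_Rintegral => x xK.
have intE v : interior v K x = v.1 K x by rewrite /interior hK patchE xK.
rewrite -intE wU !fct_sumE mulr_suml; apply: eq_bigr => k _.
by rewrite -[(_ *: _) K x]/(y k * interior (U k) K x) intE mulrA.
Qed.

Lemma interior0 : interior 0 = 0.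
Proof.
apply/funext => K; rewrite /interior; case: ifP => // _; apply/funext => x.
by rewrite patchE; case: ifP.
Qed.

(* b_h only sees the interior components: the N discrete eigenfunctions are
   b_h-orthogonal, so their interior components span [interior_space]. *)
Lemma eigenfunctions_span N lamh uh : discrete_eigensystem Omega r s A N lamh uh ->
  forall w, Vh w -> exists y : nat -> R, forall z, Vh z ->
    bh w z = \sum_(1 <= j < N.+1) y j * bh (uh j) z.
Proof.
move=> [[e [We _]] eig _ orth].
pose U (j : 'I_N) := uh j.+1.
have hj (j : 'I_N) : (0 < j.+1 <= N)%N by rewrite ltn_ord.
have VU j : Vh (U j) by have [] := eig _ (hj j).
have int_span v : Vh v -> exists c : 'I_N -> R, interior v = \sum_i c i *: e i.
  move=> hv; have : interior_space Omega r s (interior v) by exists v.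
  by rewrite We => -[c _ <-]; exists c.
have [C UC] := choice (fun j => int_span _ (VU j)).
pose Cm : 'M[R]_N := \matrix_(j, i) C j i.
have combE (y : 'rV[R]_N) :
    \sum_j y 0 j *: interior (U j) = \sum_i (y *m Cm) 0 i *: e i.
  under eq_bigr do rewrite UC scaler_sumr.
  rewrite exchange_big; apply: eq_bigr => i _.
  rewrite mxE scaler_suml; apply: eq_bigr => j _.
  by rewrite scalerA mxE.
(* Pairing a vanishing combination with [U l] in [bh] leaves only the term of index [l], whose form
   value is nonzero, so its coefficient is 0. The matrix being square, it is invertible. *)
have freeC : row_free Cm.
  apply: inj_row_free => y yC0; apply/rowP => l; rewrite mxE.
  have : interior 0 = \sum_j y 0 j *: interior (U j).
    rewrite combE yC0 interior0 big1// => i _; by rewrite mxE scale0r.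
  move=> /(bh_interior VU (VU l)) y0.
  have [_ l0 _] := eig _ (hj l).
  have : bh 0 (U l) = 0.
    by rewrite -(addNr (U l)) -scaleN1r bh_linear// mulN1r addNr.
  have bhU (j : 'I_N) : lamh j.+1 * bh (U j) (U l) = (j == l)%:R.
    have [_ _ ev] := eig _ (hj j); rewrite -ev//.
    by rewrite /U (orth _ _ (hj j) (hj l)).
  rewrite y0 (bigD1 l)//= big1 ?addr0 => [/eqP|j jl].
    rewrite mulf_eq0 => /orP[/eqP//|/eqP bUl0].
    by have /eqP := bhU l; rewrite bUl0 mulr0 eqxx eq_sym oner_eq0.
  have [_ lj0 _] := eig _ (hj j).
  have /eqP := bhU j; rewrite (negbTE jl) mulf_eq0 gt_eqF//= => /eqP ->.
  by rewrite mulr0.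
move=> w hw; have [c wc] := int_span w hw.
pose y := (\row_i c i) *m invmx Cm.
(* Eigenfunctions are numbered from 1 and ordinals from 0, hence [j.-1]; the default 0 never enters
   the sum. *)
exists (fun j => if insub j.-1 is Some i then y 0 i else 0) => z hz.
rewrite (@bh_interior _ (y 0) U)//.
  rewrite big_add1 big_mkord; apply: eq_bigr => j _ /=.
  by rewrite valK.
rewrite combE wc mulmxKV -?row_free_unit//; apply: eq_bigr => i _.
by rewrite mxE.
Qed.

End discrete_forms.

(** * The spectral gap, and the abstract estimate applied to weak Galerkin *)

Lemma spectral_gap_le (R : realType) N (lamh : nat -> R) k lam j :
  (k < j < N.+1)%N -> spectral_gap N lamh k lam <= `|(lamh j)^-1 - lam^-1|.
Proof.
move=> kjN; rewrite /spectral_gap.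
have : j \in index_iota k.+1 N.+1 by rewrite mem_index_iota.
elim: (index_iota _ _) => // i l IH; rewrite inE big_cons ge_min.
by case/predU1P => [->|/IH ->]; rewrite ?lexx ?orbT.
Qed.

Theorem theorem2p1 (R : realType) (d : nat) (hd : d = 2%N \/ d = 3%N)
  (Omega : set 'rV[R]_d) (hOmega : convex_polytopal_domain Omega)
  (A : 'rV[R]_d -> 'M[R]_d) (cA CA : R) (hcA : 0 < cA) (hCA : 0 < CA)
  (hA : coefficient Omega A cA CA)
  (lam : nat -> R) (u : nat -> sobolev R d)
  (hu : exact_eigensystem Omega A lam u)
  (M : mesh R d) (hM : is_mesh M Omega)
  (sigma tau : R) (hsigma : shape_regular M sigma) (htau : quasi_uniform M tau)
  (r s : nat) (hs : s = r \/ s = r.+1)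
  (Qh : sobolev R d -> wg M)
  (hQh : forall v, H10 Omega v -> is_Qh Omega r s v (Qh v))
  (Ph : R -> sobolev R d -> wg M)
  (hPh : forall mu v, exact_eigenpair Omega A mu v ->
    is_Ph Omega r s A mu v (Ph mu v))
  (N : nat) (lamh : nat -> R) (uh : nat -> wg M)
  (hN : discrete_eigensystem Omega r s A N lamh uh)
  (k : nat) (hk : (k < N)%N)
  (Fk : wg M -> wg M) (hF : is_spectral_projection Omega r s A uh k Fk) :
  forall i, (1 <= i <= k)%N ->
    let delta := spectral_gap N lamh k (lam i) in
    let mu := (lamh k.+1)^-1 in
    let q := Qh (u i) in
    let p := Ph (lam i) (u i) in
    0 < delta ->
    norm_ah r s A (q - Fk q) <=
      2 * norm_ah r s A (q - p) + Num.sqrt mu / delta * norm_bh (q - p) /\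
    norm_bh (q - Fk q) <= (2 + mu / delta) * norm_bh (q - p).
Proof.
move=> i hi delta mu q p delta_gt0.
have i_gt0 : (0 < i)%N by case/andP: hi.
have [/(_ i i_gt0)[lam_gt0 exact_i] _ _ _] := hu.
have [Vq Qcell _] : is_Qh Omega r s (u i) q by apply: hQh; case: exact_i.
have [Vp Peq] : is_Ph Omega r s A (lam i) (u i) p by exact: hPh.
have [_ eig lamh_le orth] := hN.
apply: (@spectral_projection_error R (wg M) (Vh Omega r s) (ah r s A) (@bh R d M)
  _ _ _ _ _ _ _ N lamh uh _ _ _ _ _ _ k Fk _ _ _ (lam i) delta q p).
- by move=> *; exact: Vh_linear.
- by move=> *; exact: (ah_linear hcA hCA hA hOmega hM).
- by move=> c u1 u2 w hu1 hu2 hw; exact: (bh_linear hM c hu1 hu2 hw).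
- exact: (ahC r s hA hM).
- exact: bhC.
- exact: (ah_ge0 r s hcA hA hM).
- exact: bh_ge0.
- by move=> j /eig[].
- by move=> j /eig[].
- by move=> j v /eig[_ _ ev]; exact: ev.
- exact: lamh_le.
- exact: orth.
- exact: (eigenfunctions_span hM hN).
- exact: hk.
- by move=> w /hF[].
- by move=> w j /hF[_ orthF]; exact: orthF.
- exact: lam_gt0.
- exact: delta_gt0.
- by move=> j; exact: spectral_gap_le.
- exact: Vq.
- exact: Vp.
(* The equation of [p] has the exact eigenfunction on its right. Replacing it by [q] is the defining
   property of the projection onto [Pol r], as [v.1 K] belongs to [Pol r]. *)
- move=> v Vv; rewrite Peq//; congr (_ * _); apply: eq_bigr => K hK.
  by rewrite Qcell//; case: Vv => /(_ K hK).
Qed.
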